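(* For each integer $n\ge 1$ and $m=n+2$ there is a uniquely optimal graph in $\mathcal{G}_{n,m}$. This graph is a balanced weak subdivision of $K_4$ (a subdivision, i.e. with all chain lengths positive, when $n\ge 4$), and it is specified up to isomorphism by the following additional conditions, where $m=6q+r$ with $q,r$ integers and $r\in\{-2,-1,0,1,2,3\}$ (so that, by balancedness, $6-|r|$ chains have length $q$ and the remaining $|r|$ chains all have length $q+1$ if $r>0$, respectively $q-1$ if $r<0$): \begin{itemize} \item If $r\in\{0,1,-1\}$, no further condition is needed. \item If $r=2$ (respectively $r=-2$), the two longer (respectively shorter) chains correspond to a matching in $K_4$. \item If $r=3$, the three longer chains correspond to a simple path with 3 edges in $K_4$. \end{itemize}
   Context: Graphs are finite connected multigraphs (multiple edges and loops allowed), considered up to isomorphism. $\mathcal{G}_{n,m}$ is the set of connected graphs with $n$ vertices and $m$ edges. For $p\in(0,1)$, $R(G,p)$ is the probability that $G$ remains connected (on all its vertices) when each edge is independently retained with probability $p$ and deleted otherwise. $G\in\mathcal{G}_{n,m}$ is uniquely optimal if $R(G,p)>R(H,p)$ for all $p\in(0,1)$ and all other graphs $H\in\mathcal{G}_{n,m}$. A weak subdivision of a cubic graph $D$ is a graph obtained as follows: assign to each edge $e$ of $D$ a nonnegative integer weight $\ell(e)$ such that every cycle of $D$ has positive total weight; contract each edge of weight $0$ and replace each edge of weight $\ell\ge1$ by a path with $\ell$ edges. The resulting object replacing an edge is a chain (a zero chain if the weight is $0$), corresponding to that edge of $D$, and its length is the weight. The weak subdivision is balanced (relative to $D$) if any two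 chain lengths, including zero lengths, differ by at most one. *)

(* Defs.v *)
From HB Require Import structures.
From mathcomp Require Import all_boot all_order all_algebra.
From mathcomp Require Import reals.

Set Implicit Arguments.
Unset Strict Implicit.
Unset Printing Implicit Defensive.

Import Order.TTheory GRing.Theory Num.Theory.
Local Open Scope ring_scope.

(* Finite multigraphs, loops and parallel edges allowed.  The orientation of
   an edge from [src] to [tgt] is an artefact of the encoding: every notion
   below sees an edge only through [joins], which is symmetric. *)
Record mgraph := MGraph {
  vertex : finType;
  edge : finType;
  src : edge -> vertex;
  tgt : edge -> vertex }.

Definition joins (G : mgraph) (e : edge G) (x y : vertex G) : bool :=
  (src e == x) && (tgt e == y) || (src e == y) && (tgt e == x).

Definition isomorphic (G H : mgraph) : Prop :=
  exists (f : vertex G -> vertex H) (g : edge G -> edge H),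
    [/\ bijective f, bijective g
      & forall e, joins (g e) (f (src e)) (f (tgt e))].

Definition adj (G : mgraph) (A : {set edge G}) : rel (vertex G) :=
  fun x y => [exists e in A, joins e x y].

Definition spanning_connected (G : mgraph) (A : {set edge G}) : bool :=
  [forall x, forall y, connect (adj A) x y].

Definition graph_class (n m : nat) (G : mgraph) : Prop :=
  [/\ #|vertex G| = n, #|edge G| = m & spanning_connected [set: edge G]].

Definition reliability (R : realType) (G : mgraph) (p : R) : R :=
  \sum_(A : {set edge G} | spanning_connected A)
    \prod_(e : edge G) (if e \in A then p else 1 - p).

(* Graphs are considered up to isomorphism, so "H other than G" means that H
   is not isomorphic to G. *)
Definition uniquely_optimal (R : realType) (n m : nat) (G : mgraph) : Prop :=
  graph_class n m G /\
  forall H : mgraph, graph_class n m H -> ~ isomorphic H G ->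
    forall p : R, 0 < p < 1 -> reliability H p < reliability G p.

(* Starting at x, each pair (e, y) of s moves along e to y. *)
Fixpoint walk (G : mgraph) (x : vertex G) (s : seq (edge G * vertex G)) : bool :=
  if s is (e, y) :: s' then joins e x y && walk y s' else true.

(* Loops are cycles of length 1, and two parallel edges form a cycle of
   length 2; distinctness of the edges excludes e, e as a cycle. *)
Definition is_cycle (G : mgraph) (x : vertex G) (s : seq (edge G * vertex G)) : bool :=
  [&& s != [::], walk x s, last x (unzip2 s) == x,
      uniq (unzip2 s) & uniq (unzip1 s)].

Definition simple_path_edges (G : mgraph) (k : nat) (S : {set edge G}) : Prop :=
  exists (x : vertex G) (s : seq (edge G * vertex G)),
    [/\ size s = k, walk x s, uniq (x :: unzip2 s)
      & S = [set e in unzip1 s]].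

Definition incident (G : mgraph) (e : edge G) (x : vertex G) : bool :=
  (src e == x) || (tgt e == x).

Definition matching (G : mgraph) (S : {set edge G}) : Prop :=
  (forall e, e \in S -> src e != tgt e) /\
  (forall e f x, e \in S -> f \in S -> incident e x -> incident f x -> e = f).

(* Contracts all the edges in Z: the vertices are the connected components of
   (V(D), Z), and the edges are those outside Z. *)
Section Contract.
Variables (D : mgraph) (Z : {set edge D}).

Definition contract_class (x : vertex D) : {set vertex D} :=
  [set y | connect (adj Z) x y].

Definition contract_vertex : finType :=
  {C : {set vertex D} | C \in codom contract_class}.

Definition contract_proj (x : vertex D) : contract_vertex :=
  Sub (contract_class x) (codom_f contract_class x).

Definition contract : mgraph :=
  @MGraph contract_vertex {e : edge D | e \notin Z}
    (fun e => contract_proj (src (val e)))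
    (fun e => contract_proj (tgt (val e))).
End Contract.

(* Meant for [l] everywhere positive: an edge with [l e = 0] would be deleted. *)
Section Subdivide.
Variables (D : mgraph) (l : edge D -> nat).

Definition subdivide_vertex : finType :=
  (vertex D + {e : edge D & 'I_(l e).-1})%type.

(* The i-th vertex (0 <= i <= l e) of the path replacing e: the endpoints of
   e for i = 0 and i = l e, and the (i-1)-th new vertex in between. *)
Definition chain_vertex (e : edge D) (i : nat) : subdivide_vertex :=
  if i is j.+1 then
    if insub j is Some k
    then inr (Tagged (fun e => 'I_(l e).-1) (k : 'I_(l e).-1))
    else inl (tgt e)
  else inl (src e).

Definition subdivide : mgraph :=
  @MGraph subdivide_vertex {e : edge D & 'I_(l e)}
    (fun a => chain_vertex (tag a) (tagged a))
    (fun a => chain_vertex (tag a) (tagged a).+1).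
End Subdivide.

Definition positive_cycles (D : mgraph) (l : edge D -> nat) : Prop :=
  forall x s, is_cycle x s -> (0 < \sum_(a <- s) l a.1)%N.

Definition weak_subdivision (D : mgraph) (l : edge D -> nat) : mgraph :=
  @subdivide (contract [set e | l e == 0%N]) (fun e => l (val e)).

Definition is_weak_subdivision (D : mgraph) (l : edge D -> nat) (G : mgraph) : Prop :=
  positive_cycles l /\ isomorphic G (weak_subdivision l).

Definition balanced (D : mgraph) (l : edge D -> nat) : Prop :=
  forall e f : edge D, (l e <= (l f).+1)%N.

Definition complete_graph (k : nat) : mgraph :=
  @MGraph 'I_k {e : 'I_k * 'I_k | (e.1 < e.2)%N}
    (fun e => (val e).1) (fun e => (val e).2).

Definition K4 : mgraph := complete_graph 4.

Definition chains (D : mgraph) (l : edge D -> nat) (k : int) : {set edge D} :=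
  [set e | (l e)%:Z == k].

(* The chains not of length q have length q + 1 if r > 0 and q - 1 if r < 0.
   For r = 0 there are none, and [q + sgz r] would be q itself. *)
Definition chain_counts (l : edge K4 -> nat) (q r : int) : Prop :=
  #|chains l q| = (6 - `|r|)%N /\
  (r != 0 -> #|chains l (q + sgz r)| = `|r|%N).

Definition chain_conditions (l : edge K4 -> nat) (q r : int) : Prop :=
  [/\ r = 2 -> matching (chains l (q + 1)),
      r = -2 -> matching (chains l (q - 1))
    & r = 3 -> simple_path_edges 3 (chains l (q + 1))].

(* Main.v *)
(* A graph with corank 3 has edge labels in F_2^3 for which the cuts are exactly
   the edge sets with label sum 0 (a representation of its bond matroid), and
   deleting a set of edges keeps the graph connected iff their labels are linearly
   independent.  So the reliability depends only on the multiplicities of the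
   labels: it is determined by the numbers N_1, N_2, N_3 of independent sets of 1,
   2 and 3 edges.  Contracting all but one edge per label leaves a graph with all
   stars of size at least 3, hence with at most six edges: some nonzero label is
   missing, and the other six are the edges of K4.  Bounding N_1, N_2, N_3
   separately over all multiplicities with sum m, N_1 is maximal iff there are no
   bridges, N_2 iff the multiplicities are balanced, and among balanced
   multiplicities N_3 selects the arrangement.  Finally the multiplicities
   determine the graph up to isomorphism: by induction, contracting on both sides
   the edge of a long chain next to a given branch vertex. *)

Require Import Defs.
From HB Require Import structures.
From mathcomp Require Import all_boot all_order all_algebra.
From mathcomp Require Import reals.
From Stdlib Require ZArith Psatz.
From mathcomp Require Import zify ring lra.

Set Implicit Arguments.
Unset Strict Implicit.
Unset Printing Implicit Defensive.

Import Order.TTheory GRing.Theory Num.Theory.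
Local Open Scope ring_scope.

(** * Cuts and edge labels *)

(** Write the multiplicities of opposite edges of $K_4$ as $a,a'$, $b,b'$, $d,d'$, with pair sums
    $x,y,z$. Then $4N_3$ is a $3\times3$ determinant with diagonal product $(x+y)(y+z)(z+x)$. That
    product alone favours nearly equal $x,y,z$. But the off-diagonal entries $a-a'$, $b-b'$, $d-d'$
    have the parities of $x,y,z$, so an odd pair sum costs a penalty. For this reason two extra
    edges go to one opposite pair (a matching), and of three extra edges two do (a path).

    Domination for every $p$ follows from one profile being best in $N_1,N_2,N_3$ simultaneously.
    Equality in all three fixes the multiplicities up to a linear map of the labels. The exception
    is three edges, where arrangements tie, but there the graph has a single vertex.

    With fewer than six edges some labels of $K_4$ do not occur, and the reconstruction by chains
    and branch vertices breaks down. Such a graph has at most three vertices, so every nonempty cut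
    is a star and the labels give the stars directly. *)

Notation label := (bool * bool * bool)%type.

Definition cut (G : mgraph) (X : {set vertex G}) : {set edge G} :=
  [set e | (src e \in X) (+) (tgt e \in X)].

Definition cut_connected (G : mgraph) :=
  forall X : {set vertex G}, cut X = set0 -> X = set0 \/ X = setT.

(* The labels of the edges are the vectors of a representation of the bond
   matroid over F_2: the cuts are exactly the edge sets with label sum 0. *)
Definition labelling (G : mgraph) (c : edge G -> label) :=
  forall S : {set edge G},
    \sum_(e in S) c e = 0 <-> exists X : {set vertex G}, S = cut X.

Lemma cut0 (G : mgraph) : cut (set0 : {set vertex G}) = set0.
Proof. by apply/setP=> e; rewrite !inE. Qed.

Lemma cutC (G : mgraph) (X : {set vertex G}) : cut (~: X) = cut X.
Proof. by apply/setP=> e; rewrite !inE addNb addbN negbK. Qed.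

Lemma cut_inj (G : mgraph) (X Y : {set vertex G}) :
  cut_connected G -> cut X = cut Y -> Y = X \/ Y = ~: X.
Proof.
move=> conG eXY.
have : cut [set x | (x \in X) (+) (x \in Y)] = set0.
  apply/setP=> e; move/setP/(_ e): eXY; rewrite !inE.
  by do 4!case: (_ \in _).
case/conG=> /setP h; [left | right]; apply/setP=> x; move: (h x); rewrite !inE;
  by do 2!case: (_ \in _).
Qed.

Lemma adj_sym (G : mgraph) (A : {set edge G}) : symmetric (adj A).
Proof.
by move=> x y; apply: eq_existsb => e; rewrite /joins orbC.
Qed.

(** The set of vertices reachable from [x] has a cut that misses [A]. Connectivity is restated
    through cuts because cuts are all that labels see. *)
Lemma spanning_connectedP (G : mgraph) (A : {set edge G}) :
  spanning_connected A <->
  forall X : {set vertex G}, cut X :&: A = set0 -> X = set0 \/ X = setT.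
Proof.
split=> [/forallP conA X cX | conA].
  case: (set_0Vmem X) => [->|[x xX]]; [by left | right].
  apply/setP=> y; rewrite inE -xX; apply/esym.
  apply: (closed_connect _ (forallP (conA x) y)) => {x xX} {}x {}y.
  case/exists_inP=> e eA exy; move/setP/(_ e): cX; rewrite !inE eA andbT.
  by case/orP: exy => /andP[/eqP-> /eqP->]; do 2!case: (_ \in X).
apply/forallP=> x; apply/forallP=> y.
have [] := conA [set y | connect (adj A) x y].
- apply/setP=> e; rewrite !inE; case: (boolP (e \in A)) => eA; last by rewrite andbF.
  have E : connect (adj A) x (src e) = connect (adj A) x (tgt e).
    apply: (same_connect_r (sym_connect_sym (@adj_sym G A))); apply: connect1.
    by apply/exists_inP; exists e; rewrite // /joins !eqxx.
  by rewrite E addbb.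
- by move/setP/(_ x); rewrite !inE connect0.
- by move/setP/(_ y); rewrite !inE.
Qed.

Lemma connectedP (G : mgraph) :
  spanning_connected [set: edge G] <-> cut_connected G.
Proof.
by rewrite spanning_connectedP; split=> h X; move: (h X); rewrite setIT.
Qed.

(** A loop lies in no star, so the handshake count sees only the other edges. Comparing with twice
    the number of all edges later detects loops. *)
Lemma sum_card_star (G : mgraph) :
  (\sum_(v : vertex G) #|cut [set v]|
     = 2 * #|[set e : edge G | src e != tgt e]|)%N.
Proof.
transitivity (\sum_(v : vertex G) \sum_(e : edge G) (e \in cut [set v] : nat))%N.
  by apply: eq_bigr => v _; rewrite -sum1_card big_mkcond.
rewrite exchange_big /= mulnC -sum_nat_const [RHS]big_mkcond /=.
apply: eq_bigr => e _.
rewrite -[LHS]big_mkcond sum1dep_card inE.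
case: eqVneq => [E|ne].
  by apply: eq_card0 => v; rewrite !inE E addbb.
rewrite -[RHS](_ : #|[set src e; tgt e]| = 2)%N; last by rewrite cards2 ne.
apply: eq_card => v; rewrite !inE ![_ == v]eq_sym.
by case: (eqVneq v (src e)) => [->|_] //=; rewrite (negbTE ne).
Qed.

Lemma sum_card_star_le (G : mgraph) :
  (\sum_(v : vertex G) #|cut [set v]| <= 2 * #|edge G|)%N.
Proof. by rewrite sum_card_star leq_mul2l /= max_card. Qed.

(** * The incidence matrix over $F_2$ and the existence of labellings *)

Section Incidence.
Variable G : mgraph.
Local Notation V := (vertex G).
Local Notation E := (edge G).

Definition incidence_mx : 'M[bool]_(#|V|, #|E|) :=
  \matrix_(i, j) (enum_val j \in cut [set enum_val i]).

Definition vertex_row (X : {set V}) : 'rV[bool]_#|V| := \row_i (enum_val i \in X).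
Definition edge_row (S : {set E}) : 'rV[bool]_#|E| := \row_j (enum_val j \in S).

Lemma edge_row_inj : injective edge_row.
Proof.
move=> S T /rowP h; apply/setP=> e; move: (h (enum_rank e)).
by rewrite !mxE enum_rankK.
Qed.

Lemma vertex_row_surj x : exists X, x = vertex_row X.
Proof.
exists [set v | x 0 (enum_rank v)]; apply/rowP=> i.
by rewrite !mxE inE enum_valK.
Qed.

Lemma edge_row_surj y : exists S, y = edge_row S.
Proof.
exists [set e | y 0 (enum_rank e)]; apply/rowP=> i.
by rewrite !mxE inE enum_valK.
Qed.

Lemma sum_eq_in (T : finType) (X : {set T}) (x : T) :
  \sum_(v in X) (x == v) = (x \in X).
Proof.
case: (boolP (x \in X)) => xX.
  rewrite (bigD1 x) //= eqxx big1 ?addr0 // => v /andP[_ /negbTE].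
  by rewrite eq_sym.
by rewrite big1 // => v vX; apply: contraNF xX => /eqP->.
Qed.

Lemma vertex_rowM X : vertex_row X *m incidence_mx = edge_row (cut X).
Proof.
apply/rowP=> j; rewrite !mxE; set e := enum_val j.
transitivity (\sum_(v in X) (e \in cut [set v])).
  rewrite [RHS]big_mkcond (reindex (@enum_val V V)) /=; last first.
    by exists enum_rank => i _; rewrite ?enum_valK ?enum_rankK.
  apply: eq_bigr => i _; rewrite !mxE.
  by case: (enum_val i \in X); rewrite ?mul1r ?mul0r.
transitivity (\sum_(v in X) ((src e == v : bool) + (tgt e == v : bool))).
  by apply: eq_bigr => v _; rewrite !inE.
by rewrite big_split /= !sum_eq_in inE.
Qed.

Lemma edge_row0 : edge_row set0 = 0.
Proof. by apply/rowP=> j; rewrite !mxE inE. Qed.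

Lemma vertex_row0 : vertex_row set0 = 0.
Proof. by apply/rowP=> j; rewrite !mxE inE. Qed.

Lemma vertex_rowT : vertex_row setT = const_mx 1.
Proof. by apply/rowP=> j; rewrite !mxE inE. Qed.

(** The left kernel consists of the vertex sets with empty cut; by connectedness these are the empty
    set and the whole set, so it is the line spanned by the all-ones row. *)
Lemma rank_incidence_mx :
  (0 < #|V|)%N -> cut_connected G -> \rank incidence_mx = #|V|.-1.
Proof.
move=> V0 conG; set B := incidence_mx.
suff : \rank (kermx B) = 1%N by rewrite mxrank_ker => h; have := rank_leq_row B; lia.
have -> : \rank (kermx B) = \rank (const_mx 1 : 'rV[bool]_#|V|).
  apply/eqmx_rank/andP; split; last first.
    by apply/sub_kermxP; rewrite -vertex_rowT vertex_rowM -(setC0 V) cutC cut0 edge_row0.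
  apply/row_subP=> i; have := row_sub i (kermx B).
  have [X ->] := vertex_row_surj (row i (kermx B)).
  move/sub_kermxP; rewrite vertex_rowM -edge_row0 => /edge_row_inj /conG [] ->.
    by rewrite vertex_row0 sub0mx.
  by rewrite vertex_rowT.
apply/eqP; rewrite eqn_leq rank_leq_row /= lt0n mxrank_eq0.
by apply/eqP=> /rowP /(_ (Ordinal V0)); rewrite !mxE.
Qed.

Lemma cut_submx S : reflect (exists X, S = cut X) (edge_row S <= incidence_mx)%MS.
Proof.
apply: (iffP submxP) => [[x]|[X ->]]; last by exists (vertex_row X); rewrite vertex_rowM.
have [X ->] := vertex_row_surj x; rewrite vertex_rowM => /edge_row_inj.
by exists X.
Qed.

Definition label_row (u : label) : 'rV[bool]_3 :=
  \row_k nth false [:: u.1.1; u.1.2; u.2] k.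

Definition row_label (r : 'rV[bool]_3) : label :=
  (r 0 (@Ordinal 3 0 isT), r 0 (@Ordinal 3 1 isT), r 0 (@Ordinal 3 2 isT)).

Lemma label_rowK : cancel label_row row_label.
Proof. by case=> [[a b] d]; rewrite /row_label !mxE. Qed.

Lemma row_labelK : cancel row_label label_row.
Proof.
move=> r; apply/rowP=> k; rewrite mxE; case: k => [[|[|[|//]]] hk] /=;
by congr (r _ _); apply/val_inj.
Qed.

Lemma label_rowD u v : label_row (u + v) = label_row u + label_row v.
Proof. by apply/rowP=> k; rewrite !mxE; case: k => [[|[|[|//]]] hk]. Qed.

Definition label_mx (c : E -> label) : 'M[bool]_(#|E|, 3) :=
  \matrix_j label_row (c (enum_val j)).

Lemma edge_rowM c S : edge_row S *m label_mx c = label_row (\sum_(e in S) c e).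
Proof.
have lr0 : label_row 0 = 0 by apply/rowP=> -[[|[|[|//]]] hk]; rewrite !mxE.
rewrite (big_morph label_row label_rowD lr0) mulmx_sum_row [RHS]big_mkcond.
rewrite [RHS](reindex (@enum_val E E)) /=; last first.
  by exists enum_rank => i _; rewrite ?enum_valK ?enum_rankK.
apply: eq_bigr => j _; rewrite rowK mxE.
by case: (_ \in S); rewrite ?scale1r ?scale0r.
Qed.

Lemma label_row_eq0 u : (label_row u == 0) = (u == 0).
Proof.
have lr0 : label_row 0 = 0 by apply/rowP=> -[[|[|[|//]]] hk]; rewrite !mxE.
by rewrite -lr0 (inj_eq (can_inj label_rowK)).
Qed.

Definition ldot (w u : label) : bool :=
  (w.1.1 && u.1.1) (+) (w.1.2 && u.1.2) (+) (w.2 && u.2).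

(** Spanning is stated dually, as no nonzero functional vanishing on all labels: this is the
    triviality of the kernel of the transposed label matrix. *)
Definition label_spanning (c : E -> label) :=
  forall w, (forall e, ldot w (c e) = false) -> w = 0.

Lemma rank_label_mx c : label_spanning c -> \rank (label_mx c) = 3%N.
Proof.
move=> spc; apply/eqP; rewrite -mxrank_tr -[_ == _]/(row_free _) -kermx_eq0.
apply/rowV0P=> r /sub_kermxP; rewrite -(row_labelK r).
set w := row_label r => h; suff -> : w = 0.
  by apply/eqP; rewrite label_row_eq0.
apply: spc => e; move/rowP/(_ (enum_rank e)): h; rewrite !mxE.
rewrite !big_ord_recr big_ord0 /= !mxE /= enum_rankK => {}h.
by apply: etrans h; rewrite /ldot add0r.
Qed.

(** The cokernel of the incidence matrix has rank $|E|-(|V|-1)=3$, and a row is killed by it exactly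
    when it is the indicator of a cut. The labels are the rows of a column basis of this
    cokernel. *)
Lemma exists_labelling :
  (0 < #|V|)%N -> cut_connected G -> #|E| = (#|V| + 2)%N ->
  exists c : E -> label, labelling c.
Proof.
move=> V0 conG nE; set B := incidence_mx.
have rB := rank_incidence_mx V0 conG.
have r3 : \rank (cokermx B) = 3%N by rewrite mxrank_coker rB nE; lia.
pose Q : 'M[bool]_(#|E|, 3) := castmx (erefl, r3) (col_base (cokermx B)).
pose c e := row_label (row (enum_rank e) Q).
have cQ : label_mx c = Q.
  by apply/row_matrixP=> j; rewrite rowK /c row_labelK enum_valK.
exists c => S; apply: (iff_trans _ (iff_sym (rwP (cut_submx S)))); rewrite submxE -/B.
apply: (@iff_trans _ (edge_row S *m Q = 0)).
  rewrite -cQ edge_rowM; split=> [->|/eqP]; first by apply/eqP; rewrite label_row_eq0.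
  by rewrite label_row_eq0 => /eqP.
rewrite -(mulmx_base (cokermx B)) mulmxA /Q.
set y := edge_row S.
apply: (@iff_trans _ (y *m col_base (cokermx B) = 0)).
  by move: (col_base _) => M; clear; case: _ / r3 in M *; rewrite castmx_id.
split=> [->|/eqP]; first by rewrite mul0mx.
move/eqP; rewrite -[0 as X in _ == X](mul0mx _ (row_base (cokermx B))).
by move/eqP/(row_free_inj (row_base_free _)).
Qed.

(** The cut space, of dimension $|V|-1$, is the kernel of the label matrix, of dimension $|E|-3$.
    This counts the vertices of a contraction without asking which contracted edges form a
    forest. *)
Lemma labelling_card c :
  (0 < #|V|)%N -> cut_connected G -> label_spanning c -> labelling c ->
  #|E| = (#|V| + 2)%N.
Proof.
move=> V0 conG spc labc; have rB := rank_incidence_mx V0 conG.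
have rQ := rank_label_mx spc.
suff : \rank incidence_mx = \rank (kermx (label_mx c)).
  have := rank_leq_row (label_mx c).
  by rewrite mxrank_ker rB rQ; lia.
apply/eqmx_rank/andP; split.
  apply/row_subP=> i; have := row_sub i incidence_mx.
  have [S ->] := edge_row_surj (row i incidence_mx).
  move/cut_submx/(labc S) => h; apply/sub_kermxP.
  by rewrite edge_rowM h; apply/eqP; rewrite label_row_eq0.
apply/row_subP=> i; have := row_sub i (kermx (label_mx c)).
have [S ->] := edge_row_surj (row i (kermx (label_mx c))).
move/sub_kermxP/eqP; rewrite edge_rowM label_row_eq0 => /eqP h.
by apply/cut_submx/(labc S).
Qed.

(** The flow condition puts the cut space inside the kernel of the label matrix, and equal
    dimensions turn the inclusion into equality. *)
Lemma labelling_of_flow c :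
  (0 < #|V|)%N -> cut_connected G -> #|E| = (#|V| + 2)%N -> label_spanning c ->
  (forall X, \sum_(e in cut X) c e = 0) -> labelling c.
Proof.
move=> V0 conG nE spc flow S; split=> [S0|[X ->]]; last exact: flow.
apply/cut_submx; have rB := rank_incidence_mx V0 conG.
have rQ := rank_label_mx spc.
have sBK : (incidence_mx <= kermx (label_mx c))%MS.
  apply/row_subP=> i; have := row_sub i incidence_mx.
  have [T ->] := edge_row_surj (row i incidence_mx).
  move/cut_submx => [X ->]; apply/sub_kermxP.
  by rewrite edge_rowM flow; apply/eqP; rewrite label_row_eq0.
have /eqmxP/eqmx_sym h : (incidence_mx == kermx (label_mx c))%MS.
  by rewrite -(geq_leqif (mxrank_leqif_eq sBK)) mxrank_ker rB rQ nE; lia.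
rewrite -h; apply/sub_kermxP.
by rewrite edge_rowM S0; apply/eqP; rewrite label_row_eq0.
Qed.
End Incidence.

Lemma label_addxx (u : label) : u + u = 0.
Proof. by case: u => [[[] []] []]. Qed.

Lemma label_add_eq0 (u v : label) : (u + v == 0) = (u == v).
Proof. by case: u => [[[] []] []]; case: v => [[[] []] []]. Qed.

(** * Cuts and labellings under contraction *)

Section Quotient.
Variables (G H : mgraph) (p : vertex G -> vertex H) (i : edge H -> edge G).
Hypotheses (i_inj : injective i) (p_surj : forall y, exists x, p x = y).
Hypotheses (srcE : forall e, src e = p (src (i e)))
           (tgtE : forall e, tgt e = p (tgt (i e))).
Hypothesis p_contr : forall e, e \notin codom i -> p (src e) = p (tgt e).
Hypothesis p_sat : forall X : {set vertex G},
  (forall e, e \notin codom i -> e \notin cut X) ->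
  forall x y, p x = p y -> x \in X -> y \in X.

Lemma cut_quotient (Y : {set vertex H}) : i @: cut Y = cut (p @^-1: Y).
Proof.
apply/setP=> e; apply/imsetP/idP => [[f fY ->]|].
  by move: fY; rewrite !inE srcE tgtE.
rewrite !inE; case: (boolP (e \in codom i)) => [/codomP[f ->]|/p_contr->].
  by rewrite -srcE -tgtE => fY; exists f; rewrite // inE.
by rewrite addbb.
Qed.

(** By [p_sat], a vertex set whose cut avoids the contracted edges is a union of fibres of [p], so
    it comes from the quotient. *)
Lemma cut_quotient_lift (X : {set vertex G}) (S : {set edge H}) :
  i @: S = cut X -> exists2 Y : {set vertex H}, X = p @^-1: Y & S = cut Y.
Proof.
move=> eS; have XE : X = p @^-1: (p @: X).
  apply/setP=> x; rewrite inE; apply/idP/imsetP => [xX|[y yX exy]].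
    by exists x.
  apply: p_sat (esym exy) yX => e ne; rewrite -eS; apply: contra ne.
  by case/imsetP=> f _ ->; exact: codom_f.
exists (p @: X); first exact: XE.
by apply: (imset_inj i_inj); rewrite eS cut_quotient -XE.
Qed.

Lemma labelling_quotient c : labelling c -> labelling (c \o i).
Proof.
move=> labc S.
have -> : \sum_(e in S) (c \o i) e = \sum_(e in i @: S) c e.
  by rewrite big_imset //= => x y _ _; exact: i_inj.
rewrite (labc (i @: S)); split=> [[X]|[Y ->]].
  by case/cut_quotient_lift=> Y _ ->; exists Y.
by exists (p @^-1: Y); rewrite cut_quotient.
Qed.

Lemma cut_connected_quotient : cut_connected G -> cut_connected H.
Proof.
move=> conG Y Y0; have := cut_quotient Y; rewrite Y0 imset0 => /esym/conG [] /setP h.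
  by left; apply/setP=> y; have [x <-] := p_surj y; move: (h x); rewrite !inE.
by right; apply/setP=> y; have [x <-] := p_surj y; move: (h x); rewrite !inE.
Qed.
End Quotient.

Section ContractLabelling.
Variables (G : mgraph) (Z : {set edge G}).

Lemma contract_proj_eqP (x y : vertex G) :
  contract_proj Z x = contract_proj Z y <-> connect (adj Z) x y.
Proof.
split=> [/(congr1 val)/= /setP/(_ y)|xy]; first by rewrite !inE connect0.
apply/val_inj/setP=> z; rewrite !inE.
exact: (same_connect (sym_connect_sym (@adj_sym G Z))).
Qed.

Lemma contract_proj_surj (C : vertex (contract Z)) : exists x, contract_proj Z x = C.
Proof.
by case: C => C hC; have /codomP[x eC] := hC; exists x; apply/val_inj.
Qed.

Lemma codom_edge_contract e : (e \notin codom (val : edge (contract Z) -> edge G)) = (e \in Z).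
Proof.
apply/idP/idP => [|eZ]; last by apply/codomP=> -[[f fZ] /= ef]; rewrite -ef eZ in fZ.
by apply: contraR => eZ; apply/codomP; exists (Sub e eZ).
Qed.

Lemma contract_proj_joins e : e \in Z -> contract_proj Z (src e) = contract_proj Z (tgt e).
Proof.
move=> eZ; apply/contract_proj_eqP/connect1/exists_inP; exists e => //.
by rewrite /joins !eqxx.
Qed.

Lemma contract_proj_sat (X : {set vertex G}) :
  (forall e, e \in Z -> e \notin cut X) ->
  forall x y, contract_proj Z x = contract_proj Z y -> x \in X -> y \in X.
Proof.
move=> hX x y /contract_proj_eqP xy; rewrite (closed_connect _ xy) //.
move=> {x xy} {}x {}y /exists_inP[e /hX]; rewrite !inE => eX exy.
by case/orP: exy eX => /andP[/eqP-> /eqP->]; do 2!case: (_ \in X).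
Qed.

Lemma labelling_contract (c : edge G -> label) :
  labelling c -> labelling (c \o val : edge (contract Z) -> label).
Proof.
apply: (@labelling_quotient G (contract Z) (contract_proj Z) val) => //.
- exact: val_inj.
  by move=> e; rewrite codom_edge_contract; exact: contract_proj_joins.
move=> X hX; apply: contract_proj_sat => e eZ; apply: hX.
by rewrite codom_edge_contract.
Qed.

Lemma cut_connected_contract : cut_connected G -> cut_connected (contract Z).
Proof.
apply: (@cut_connected_quotient G (contract Z) (contract_proj Z) val) => //.
  exact: contract_proj_surj.
by move=> e; rewrite codom_edge_contract; exact: contract_proj_joins.
Qed.

Lemma cut_contract (Y : {set vertex (contract Z)}) :
  val @: cut Y = cut (contract_proj Z @^-1: Y).
Proof.
apply: (@cut_quotient G (contract Z) (contract_proj Z) val) => //.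
by move=> e; rewrite codom_edge_contract; exact: contract_proj_joins.
Qed.
End ContractLabelling.

Lemma cut_star_neq0 (G : mgraph) (v : vertex G) :
  cut_connected G -> (1 < #|vertex G|)%N -> cut [set v] != set0.
Proof.
move=> conG n2; apply/eqP=> /conG [/setP/(_ v)|h]; first by rewrite !inE eqxx.
by move: n2; rewrite -cardsT -h cards1.
Qed.

(** * Distinct nonzero labels, and the missing label *)

Section SimpleLabelling.
Variables (G : mgraph) (c : edge G -> label).
Hypotheses (conG : cut_connected G) (labc : labelling c).
Hypothesis c_neq0 : forall e, c e != 0.

Lemma sum_star (v : vertex G) : \sum_(e in cut [set v]) c e = 0.
Proof. by apply/(labc (cut [set v])); exists [set v]. Qed.

(** The labels of a star add up to 0, so the edge of a one-edge star would have label 0. *)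
Lemma card_star_gt1 (v : vertex G) : (1 < #|vertex G|)%N -> (1 < #|cut [set v]|)%N.
Proof.
move=> n2; have := cut_star_neq0 v conG n2; rewrite -card_gt0.
case E: #|cut [set v]| => [|[|k]] // _.
move/eqP/cards1P: E => [e eS]; have := sum_star v.
by rewrite eS big_set1 => /eqP; rewrite (negbTE (c_neq0 e)).
Qed.

Lemma card_star2 (v : vertex G) : #|cut [set v]| = 2%N ->
  exists e f, [/\ e != f, cut [set v] = [set e; f] & c e = c f].
Proof.
move=> h; have /cards2P[e [f [ef eS]]] : (#|cut [set v]| == 2)%N by rewrite h.
exists e, f; split=> //.
by have /eqP := sum_star v; rewrite eS big_setU1 ?inE //= big_set1 label_add_eq0 => /eqP.
Qed.

Lemma card_star_gt2 (v : vertex G) : injective c -> (1 < #|vertex G|)%N -> (2 < #|cut [set v]|)%N.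
Proof.
move=> c_inj n2; have := card_star_gt1 v n2; rewrite leq_eqVlt => /orP[/eqP/esym|//].
by case/card_star2=> e [f [/eqP ef _ /c_inj]].
Qed.

(** A star of two edges would repeat a label, so $3|V|\le 2|E|=2|V|+4$. *)
Lemma simple_card_edge : injective c -> label_spanning c -> (0 < #|vertex G|)%N ->
  (#|edge G| <= 6)%N.
Proof.
move=> c_inj spc n0; have := labelling_card n0 conG spc labc.
case: (ltnP 1 #|vertex G|) => n2; last by lia.
have := sum_card_star_le G.
have : (\sum_(v : vertex G) 3 <= \sum_(v : vertex G) #|cut [set v]|)%N.
  by apply: leq_sum => v _; exact: card_star_gt2.
rewrite sum_nat_const -[#|xpredT|]/#|vertex G|; lia.
Qed.
End SimpleLabelling.

Section Representatives.
Variables (G : mgraph) (c : edge G -> label).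
(** The result of [pick] depends only on the label, so exactly one edge is elected for each nonzero
    label that occurs. Edges of label 0, the bridges, are left out. *)
Definition representatives : {set edge G} :=
  [set e | (c e != 0) && ([pick f | c f == c e] == Some e)].

Let H := contract (~: representatives).
Let cH : edge H -> label := c \o val.

Lemma representatives_inj : injective cH.
Proof.
case=> e he [f hf] /= ef; apply/val_inj => /=; rewrite /cH /= in ef.
move: (he) (hf); rewrite !inE !negbK ef => /andP[_ /eqP->] /andP[_ /eqP].
by case.
Qed.

Lemma representatives_neq0 e : cH e != 0.
Proof. by have := valP e; rewrite !inE negbK => /andP[]. Qed.

Lemma representatives_onto e : c e != 0 -> exists f, cH f = c e.
Proof.
move=> e0; case: (pickP (fun f => c f == c e)) => [f /eqP fe|/(_ e)]; last by rewrite eqxx.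
pose g := odflt e [pick f | c f == c e].
have ge : c g = c e by rewrite /g; case: pickP => [? /eqP|].
suff hg : g \notin ~: representatives by exists (Sub g hg).
rewrite !inE negbK ge e0 /=; rewrite /g; case: pickP => [//|/(_ e)].
by rewrite eqxx.
Qed.
End Representatives.

Lemma ldot_eq0 w : ldot w (true, false, false) = false ->
  ldot w (false, true, false) = false -> ldot w (false, false, true) = false -> w = 0.
Proof. by case: w => [[[] []] []]. Qed.

(** If all seven nonzero labels occurred, contracting all edges but the representatives would leave
    seven edges with distinct nonzero labels, against the bound six. *)
Lemma missing_label (G : mgraph) (c : edge G -> label) :
  (0 < #|vertex G|)%N -> cut_connected G -> labelling c ->
  exists2 g, g != 0 & forall e, c e != g.
Proof.
move=> n0 conG labc.
case: (boolP [exists g : label, (g != 0) && [forall e, c e != g]]).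
  by case/existsP=> g /andP[g0 /forallP h]; exists g.
rewrite negb_exists => /forallP full; exfalso.
pose Z := ~: representatives c; pose d := c \o val : edge (contract Z) -> label.
have onto u : u != 0 -> exists f, d f = u.
  move=> u0; move: (full u); rewrite u0 /= negb_forall => /existsP[e].
  rewrite negbK => /eqP eu; move: u0; rewrite -eu; exact: representatives_onto.
have spd : label_spanning d.
  move=> w hw.
  by apply: ldot_eq0; [case: (onto (true, false, false)) |
    case: (onto (false, true, false)) | case: (onto (false, false, true))] => // f <-.
have n0' : (0 < #|vertex (contract Z)|)%N.
  by case/card_gt0P: n0 => x _; apply/card_gt0P; exists (contract_proj Z x).
have := simple_card_edge (cut_connected_contract (Z := Z) conG)
  (labelling_contract (Z := Z) labc) (@representatives_neq0 _ c)
  (@representatives_inj _ c) spd n0'.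
apply/negP; rewrite -ltnNge.
have : (#|[set d e | e : edge (contract Z)]| <= #|edge (contract Z)|)%N.
  exact: leq_imset_card.
apply: leq_trans.
have -> : [set d e | e : edge (contract Z)] = [set~ (false, false, false)].
  apply/setP=> u; rewrite !inE; apply/imsetP/idP=> [[e _ ->]|/onto[f <-]]; last by exists f.
  exact: representatives_neq0.
by rewrite cardsC1 !card_prod card_bool.
Qed.

Lemma labelling_comp (G : mgraph) (c : edge G -> label) (phi : label -> label) :
  {morph phi : u v / u + v} -> injective phi -> labelling c -> labelling (phi \o c).
Proof.
move=> phiD phi_inj labc S; rewrite -(labc S).
have phi0 : phi 0 = 0 by apply: (addrI (phi 0)); rewrite -phiD !addr0.
rewrite /comp -(big_morph phi phiD phi0).
by split=> [h|->]; [apply: phi_inj; rewrite h phi0 | exact: phi0].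
Qed.

(** * Reliability and independent sets of labels *)

Section Independent.
Variables (G : mgraph) (c : edge G -> label).
Local Notation E := (edge G).

Definition independent (S : {set E}) : bool :=
  [forall T : {set E}, (T \subset S) && (\sum_(e in T) c e == 0) ==> (T == set0)].

Lemma independentP (S : {set E}) :
  reflect (forall T : {set E}, T \subset S -> \sum_(e in T) c e = 0 -> T = set0)
          (independent S).
Proof.
apply: (iffP forallP) => [h T TS T0|h T].
  by apply/eqP; move: (h T); rewrite TS T0 eqxx.
by apply/implyP=> /andP[TS /eqP/(h T TS)->].
Qed.

(** Deleting [S] disconnects the graph exactly when [S] contains a nonempty cut, that is, a nonempty
    set of label sum 0. *)
Lemma spanning_connected_setC (S : {set E}) :
  cut_connected G -> labelling c -> spanning_connected (~: S) = independent S.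
Proof.
move=> conG labc; apply/idP/independentP => [/spanning_connectedP con T TS|ind].
  case/(labc T)=> X TX; rewrite TX; case: (con X) => [|->|->].
  - by apply/eqP; rewrite setI_eq0 disjoints_subset setCK -TX.
  - by rewrite cut0.
  - by rewrite -setC0 cutC cut0.
apply/spanning_connectedP=> X /eqP; rewrite setI_eq0 disjoints_subset setCK => XS.
by apply: conG; apply: ind XS _; apply/(labc (cut X)); exists X.
Qed.

Lemma sum_setX (T U : {set E}) :
  \sum_(e in (T :\: U) :|: (U :\: T)) c e = \sum_(e in T) c e + \sum_(e in U) c e.
Proof.
rewrite [LHS]big_mkcond [X in _ = X + _]big_mkcond [X in _ = _ + X]big_mkcond -big_split.
apply: eq_bigr => e _; rewrite !inE.
by case: (e \in T); case: (e \in U); rewrite /= ?addr0 ?add0r ?label_addxx.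
Qed.

(** Distinct subsets of an independent set have distinct label sums, and there are only eight
    labels. *)
Lemma independent_card (S : {set E}) : independent S -> (#|S| <= 3)%N.
Proof.
move/independentP=> ind; pose f (T : {set E}) := \sum_(e in T) c e.
have f_inj : {in powerset S &, injective f}.
  move=> T U; rewrite !inE => TS US eTU.
  have /setP h : (T :\: U) :|: (U :\: T) = set0.
    apply: ind; first by rewrite subUset !(subset_trans (subsetDl _ _)).
    by rewrite sum_setX -/(f T) -/(f U) eTU label_addxx.
  by apply/setP=> e; move: (h e); rewrite !inE; do 2!case: (e \in _).
rewrite -(leq_exp2l (m := 2)) // -card_powerset -(card_in_imset f_inj).
by apply: leq_trans (max_card _) _; rewrite !card_prod card_bool.
Qed.

Definition independents k : nat := #|[set S | independent S & #|S| == k]|.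

Lemma reliability_independents (R : realType) (p : R) :
  cut_connected G -> labelling c ->
  reliability G p =
    \sum_(k < 4) (independents k)%:R * (p ^+ (#|E| - k) * (1 - p) ^+ k).
Proof.
(* From here the sum runs over the set of deleted edges instead of the set of retained ones. *)
move=> conG labc; rewrite /reliability (reindex_inj (@setC_inj E)) /=.
under eq_bigl do rewrite spanning_connected_setC //.
pose w k := p ^+ (#|E| - k) * (1 - p) ^+ k.
transitivity (\sum_(S | independent S) w #|S|).
  apply: eq_bigr => S _; rewrite (bigID (mem S)) /= mulrC.
  congr (_ * _); last first.
    rewrite (eq_bigr (fun=> 1 - p)) ?prodr_const // => e eS.
    by rewrite inE eS.
  rewrite (eq_bigr (fun=> p)) => [|e eS]; last by rewrite inE eS.
  rewrite prodr_const; congr (_ ^+ _); rewrite -(cardsC S) addKn.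
  apply: eq_card => e.
  by rewrite inE.
transitivity (\sum_(k < 4) \sum_(S | independent S && (#|S| == k)) w k); last first.
  apply: eq_bigr => k _; rewrite sumr_const mulr_natl; congr (_ *+ _).
  by apply: eq_card => S; rewrite inE.
rewrite (partition_big (fun S : {set E} => inord #|S| : 'I_4) xpredT) //=.
apply: eq_bigr => k _; apply: eq_big => [S|S /andP[indS /eqP<-]].
  case indS : (independent S) => //=.
  by rewrite -(inj_eq val_inj) /= inordK // ltnS independent_card.
by rewrite inordK // ltnS independent_card.
Qed.
End Independent.

(** * Counting independent sets through the multiplicities of labels *)

Section SubsetsOfSizeTwoAndThree.
Variables (T : finType) (F : pred {set T}).

(** Ordered tuples split into iterated sums over edges, hence over labels. The factors 2 here and 6
    below count the orderings of a set. *)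
Lemma card_ordered_pairs :
  (\sum_x \sum_y ((x != y) && F [set x; y] : nat)
     = 2 * #|[set S : {set T} | F S & #|S| == 2]|)%N.
Proof.
rewrite pair_big /= -big_mkcond /=.
rewrite (partition_big (fun p : T * T => [set p.1; p.2])
          (mem [set S : {set T} | F S & #|S| == 2])) /=; last first.
  by move=> [x y] /= /andP[xy FS]; rewrite inE FS cards2 xy.
rewrite mulnC -sum_nat_const; apply: eq_bigr => S; rewrite inE => /andP[FS].
case/cards2P=> a [b [ab eS]]; rewrite sum1dep_card.
rewrite -[RHS](_ : #|[set (a, b); (b, a)]| = 2)%N; last first.
  by rewrite cards2 xpair_eqE (negbTE ab).
apply: eq_card => -[x y]; rewrite !inE !xpair_eqE /=; apply/idP/idP.
  case/andP=> /andP[xy _] /eqP; rewrite eS => /setP h.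
  move: (h x) (h y); rewrite !inE !eqxx orbT /=.
  case: (eqVneq x a) xy => [->|_]; case: (eqVneq y b) => [->|_] //=;
    rewrite ?eqxx ?orbT ?orbF //= => xy.
  + by move=> _ /esym; rewrite eq_sym (negbTE xy).
  + by move=> /esym; rewrite (negbTE xy).
  + by move=> /esym-> /esym->.
have swap : [set b; a] = [set a; b] by rewrite setUC.
by case/orP=> /andP[/eqP-> /eqP->]; rewrite ?swap -eS FS eqxx ?ab // eq_sym ab.
Qed.

Lemma card_ordered_triples :
  (\sum_x \sum_y \sum_z (uniq [:: x; y; z] && F [set x; y; z] : nat)
     = 6 * #|[set S : {set T} | F S & #|S| == 3]|)%N.
Proof.
under eq_bigr do rewrite pair_big /=.
rewrite pair_big /= -big_mkcond /=.
rewrite (partition_big (fun p : T * (T * T) => [set p.1; p.2.1; p.2.2])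
          (mem [set S : {set T} | F S & #|S| == 3])) /=; last first.
  move=> [x [y z]] /= /andP[xyz FS]; rewrite inE FS /=.
  have -> : #|[set x; y; z]| = #|[:: x; y; z]|.
    by apply: eq_card => t; rewrite !inE orbA.
  by rewrite (card_uniqP (xyz : uniq [:: x; y; z])).
rewrite mulnC -sum_nat_const; apply: eq_bigr => S; rewrite inE => /andP[FS cS].
rewrite sum1dep_card.
have /card_uniqP : uniq (enum S) := enum_uniq S.
have sS : size (enum S) = 3%N by rewrite -cardE (eqP cS).
rewrite cardE; have := enum_uniq S; have memS := mem_enum S.
case: (enum S) sS memS => [|a [|b [|d [|]]]] //= _ memS abd _.
have eS : S = [set a; b; d] by apply/setP=> t; rewrite -memS !inE orbA.
have {}abd : [/\ a != b, a != d & b != d].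
  move: abd; rewrite !inE negb_or andbT. by rewrite -andbA => /and3P.
case: abd => ab ad bd.
pose L := [:: (a, (b, d)); (a, (d, b)); (b, (a, d)); (b, (d, a)); (d, (a, b)); (d, (b, a))].
have uL : uniq L.
  by rewrite /= !inE !xpair_eqE !eqxx ![b == a]eq_sym ![d == a]eq_sym ![d == b]eq_sym
    !(negbTE ab) !(negbTE ad) !(negbTE bd).
rewrite -[6%N]/(size L) -(card_uniqP uL) -cardE; apply: eq_card => -[x [y z]].
rewrite [LHS]inE [X in X = _]/=; apply/idP/idP.
  case/andP=> /andP[xyz _] /eqP; rewrite eS => /setP h.
  move: (h x) (h y) (h z) xyz; rewrite !inE !eqxx ?orbT /= => /esym hx /esym hy /esym hz.
  by case/orP: hx => [/orP[]|] /eqP->; case/orP: hy => [/orP[]|] /eqP->;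
     case/orP: hz => [/orP[]|] /eqP->; rewrite ?eqxx ?orbT ?andbF.
rewrite inE; have ba : b != a by rewrite eq_sym.
have da : d != a by rewrite eq_sym.
have db : d != b by rewrite eq_sym.
have P (x1 y1 z1 : T) : [set x1; y1; z1] =i [:: x1; y1; z1].
  by move=> t; rewrite !inE orbA.
have : perm_eq [:: x; y; z] [:: a; b; d] -> 
   (uniq [:: x; y; z] && F [set x; y; z]) && ([set x; y; z] == S).
  move=> pxyz; have -> : [set x; y; z] = S.
    by apply/setP=> t; rewrite eS !P (perm_mem pxyz).
  by rewrite FS eqxx !andbT (perm_uniq pxyz) /= !inE negb_or ab ad bd.
move=> h hL; apply: h.
move: hL; rewrite !inE !xpair_eqE.
by repeat (case/orP); case/andP=> /eqP-> /andP[/eqP-> /eqP->];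
  apply/permP=> q /=; do 3!case: (q _).
Qed.
End SubsetsOfSizeTwoAndThree.

Definition independent2 (u v : label) : bool := [&& u != 0, v != 0 & u != v].
Definition independent3 (u v w : label) : bool :=
  [&& u != 0, v != 0, w != 0, u != v, u != w, v != w & u + v + w != 0].

Definition mult (G : mgraph) (c : edge G -> label) (u : label) : nat :=
  #|[set e | c e == u]|.

Lemma big_label (R : Type) (idx : R) (op : Monoid.com_law idx) (h : label -> R) :
  \big[op/idx]_u h u =
  op (op (op (op (op (op (op (h (true, true, true)) (h (true, true, false)))
    (h (true, false, true))) (h (true, false, false))) (h (false, true, true)))
    (h (false, true, false))) (h (false, false, true))) (h (false, false, false)).
Proof.
rewrite (eq_bigr (fun u => h (u.1, u.2))); last by case.
rewrite -(pair_bigA _ (fun p b => h (p, b))) /=.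
rewrite (eq_bigr (fun p => \big[op/idx]_b h (p.1, p.2, b))); last by case.
rewrite -(pair_bigA _ (fun a b => \big[op/idx]_d h (a, b, d))) /=.
by rewrite big_bool /= !big_bool /= ?big_bool /= ?big_bool /= !Monoid.mulmA.
Qed.

Lemma sum_label (h : label -> nat) : (\sum_u h u =
  h (true, true, true) + h (true, true, false) + h (true, false, true)
  + h (true, false, false) + h (false, true, true) + h (false, true, false)
  + h (false, false, true) + h (false, false, false))%N.
Proof. exact: big_label. Qed.

Section LabelSums.
Variables (G : mgraph) (c : edge G -> label).

Lemma sum_mult (h : label -> nat) : (\sum_e h (c e) = \sum_u mult c u * h u)%N.
Proof.
rewrite (partition_big c xpredT) //=; apply: eq_bigr => u _.
rewrite (eq_bigr (fun=> h u)) => [|e /eqP-> //].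
by rewrite sum_nat_const; congr (_ * _)%N; apply: eq_card => e; rewrite inE.
Qed.

Lemma sum_subset3 (x y z : edge G) (T : {set edge G}) :
  uniq [:: x; y; z] -> T \subset [set x; y; z] ->
  \sum_(e in T) c e = (if x \in T then c x else 0) + (if y \in T then c y else 0)
                      + (if z \in T then c z else 0).
Proof.
rewrite /= !inE andbT negb_or -andbA => /and3P[xy xz yz] /subsetP TS.
rewrite (bigID (fun e => e \in [set x; y; z])) /= [X in _ + X]big1 ?addr0; last first.
  by move=> e /andP[/TS ->].
rewrite big_andbC big_mkcondr /= -setUA big_setU1 ?inE ?negb_or ?xy ?xz //=.
by rewrite big_setU1 ?inE ?yz //= big_set1 addrA.
Qed.

Lemma independent_set3 (x y z : edge G) :
  uniq [:: x; y; z] && independent c [set x; y; z] = independent3 (c x) (c y) (c z).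
Proof.
apply/andP/idP => [[xyz /independentP ind]|].
  have S3 := sum_subset3 xyz.
  have [xy xz yz] : [/\ x != y, x != z & y != z].
    by move: xyz; rewrite /= !inE andbT negb_or -andbA => /and3P.
  have no (T : {set edge G}) t : T \subset [set x; y; z] -> t \in T ->
      (\sum_(e in T) c e) != 0.
    by move=> TS tT; apply/eqP=> /(ind T TS) T0; rewrite T0 inE in tT.
  have xS : x \in [set x; y; z] by rewrite !inE eqxx.
  have yS : y \in [set x; y; z] by rewrite !inE eqxx orbT.
  have zS : z \in [set x; y; z] by rewrite !inE eqxx orbT.
  apply/and5P; split; last apply/and3P; try split.
  - by have := no [set x] x; rewrite big_set1 sub1set set11 xS; apply.
  - by have := no [set y] y; rewrite big_set1 sub1set set11 yS; apply.
  - by have := no [set z] z; rewrite big_set1 sub1set set11 zS; apply.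
  - have := no [set x; y] x; rewrite big_setU1 ?inE //= big_set1 label_add_eq0; apply.
      by rewrite subUset !sub1set xS yS.
    by rewrite ?inE ?eqxx.
  - have := no [set x; z] x; rewrite big_setU1 ?inE //= big_set1 label_add_eq0; apply.
      by rewrite subUset !sub1set xS zS.
    by rewrite ?inE ?eqxx.
  - have := no [set y; z] y; rewrite big_setU1 ?inE //= big_set1 label_add_eq0; apply.
      by rewrite subUset !sub1set yS zS.
    by rewrite ?inE ?eqxx.
  - have := no [set x; y; z] x (subxx _) xS; by rewrite S3 // xS yS zS.
case/and5P=> x0 y0 z0 xy /and3P[xz yz xyz].
have u3 : uniq [:: x; y; z].
  by rewrite /= !inE andbT negb_or -andbA; apply/and3P; split;
     [apply: contraNneq xy | apply: contraNneq xz | apply: contraNneq yz] => ->.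
split=> //; apply/independentP=> T TS; rewrite (sum_subset3 u3 TS) => /eqP.
case xT: (x \in T); case yT: (y \in T); case zT: (z \in T);
  rewrite ?add0r ?addr0 ?label_add_eq0 ?(negbTE x0) ?(negbTE y0) ?(negbTE z0)
    ?(negbTE xy) ?(negbTE xz) ?(negbTE yz) //.
  by rewrite -label_add_eq0 (negbTE xyz).
move=> _; apply/setP=> e; rewrite inE; apply/negP=> eT.
have := subsetP TS e eT; rewrite !inE => /orP[/orP[]|] /eqP ee; 
by rewrite ee ?xT ?yT ?zT in eT.
Qed.

Lemma independent_set2 (x y : edge G) :
  (x != y) && independent c [set x; y] = independent2 (c x) (c y).
Proof.
apply/andP/idP => [[xy /independentP ind]|].
  have no (T : {set edge G}) t : T \subset [set x; y] -> t \in T ->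
      (\sum_(e in T) c e) != 0.
    by move=> TS tT; apply/eqP=> /(ind T TS) T0; rewrite T0 inE in tT.
  have xS : x \in [set x; y] by rewrite !inE eqxx.
  have yS : y \in [set x; y] by rewrite !inE eqxx orbT.
  apply/and3P; split.
  - by have := no [set x] x; rewrite big_set1 sub1set set11 xS; apply.
  - by have := no [set y] y; rewrite big_set1 sub1set set11 yS; apply.
  - by have := no [set x; y] x; rewrite subxx xS big_setU1 ?inE //= big_set1 label_add_eq0; apply.
case/and3P=> x0 y0 cxy; have xy : x != y by apply: contraNneq cxy => ->.
split=> //; apply/independentP=> T /subsetP TS.
rewrite (bigID (fun e => e \in [set x; y])) /= [X in _ + X]big1 ?addr0; last first.
  by move=> e /andP[/TS ->].
rewrite big_andbC big_mkcondr /= big_setU1 ?inE //= big_set1.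
case xT: (x \in T); case yT: (y \in T);
  rewrite ?add0r ?addr0; move=> /eqP;
  rewrite ?label_add_eq0 ?(negbTE x0) ?(negbTE y0) ?(negbTE cxy) //.
move=> _; apply/setP=> e; rewrite inE; apply/negP=> eT.
by have := TS e eT; rewrite !inE => /orP[] /eqP ee; rewrite ee ?xT ?yT in eT.
Qed.

Lemma independents0 : independents c 0 = 1%N.
Proof.
rewrite /independents -(cards1 (set0 : {set edge G})); apply: eq_card => S.
rewrite !inE cards_eq0 andbC; case: eqP => //= ->.
by apply/independentP=> T; rewrite subset0 => /eqP.
Qed.

Lemma independents1 : independents c 1 = (\sum_u mult c u * (u != 0%R))%N.
Proof.
rewrite -(sum_mult (fun u => u != 0 : nat)) -big_mkcond sum1_card /independents.
rewrite -(card_imset (mem [pred e | c e != 0]) set1_inj); apply: eq_card => S.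
rewrite !inE; apply/andP/imsetP => [[/independentP ind /cards1P[e eS]]|[e]].
  exists e => //; rewrite inE; apply/eqP=> ce0.
  have : S = set0 by apply: ind => //; rewrite eS big_set1.
  by rewrite eS => /setP/(_ e); rewrite !inE eqxx.
rewrite inE => ce0 ->; rewrite cards1; split=> //; apply/independentP=> T.
by rewrite subset1 => /orP[] /eqP-> //; rewrite big_set1 => /eqP; rewrite (negbTE ce0).
Qed.

Lemma independents2 : (2 * independents c 2 =
  \sum_u mult c u * \sum_v mult c v * independent2 u v)%N.
Proof.
rewrite -card_ordered_pairs.
rewrite -(sum_mult (fun u => \sum_v mult c v * independent2 u v))%N.
apply: eq_bigr => x _; rewrite -(sum_mult (fun v => independent2 (c x) v : nat)).
by apply: eq_bigr => y _; rewrite independent_set2.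
Qed.

Lemma independents3 : (6 * independents c 3 =
  \sum_u mult c u * \sum_v mult c v * \sum_w mult c w * independent3 u v w)%N.
Proof.
rewrite -card_ordered_triples.
rewrite -(sum_mult (fun u => \sum_v mult c v * \sum_w mult c w * independent3 u v w))%N.
apply: eq_bigr => x _.
rewrite -(sum_mult (fun v => \sum_w mult c w * independent3 (c x) v w))%N.
apply: eq_bigr => y _.
rewrite -(sum_mult (fun w => independent3 (c x) (c y) w : nat)).
by apply: eq_bigr => z _; rewrite independent_set3.
Qed.

Lemma card_edge_mult : #|edge G| = (\sum_u mult c u)%N.
Proof.
by rewrite -sum1_card (sum_mult (fun=> 1%N)); apply: eq_bigr => u _; rewrite muln1.
Qed.
End LabelSums.

Section Profile.
Variable l : label -> nat.
Local Notation a := (l (true, false, false)).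
Local Notation a' := (l (false, true, true)).
Local Notation b := (l (false, true, false)).
Local Notation b' := (l (true, false, true)).
Local Notation d := (l (false, false, true)).
Local Notation d' := (l (true, true, false)).

Definition profile1 : nat := (a + a' + b + b' + d + d')%N.
Definition profile2 : nat :=
  (a * a' + b * b' + d * d' + (a + a') * (b + b') + (a + a') * (d + d')
   + (b + b') * (d + d'))%N.
(** Primed and unprimed letters are opposite edges of $K_4$: their labels add up to the missing one.
    Of the 20 triples the four absent ones, $abd'$, $ab'd$, $a'bd$ and $a'b'd'$, are the stars of
    $K_4$, with label sum 0. The value counts complements of spanning trees. *)
Definition profile3 : nat :=
  (a * a' * (b + b' + d + d') + b * b' * (a + a' + d + d') + d * d' * (a + a' + b + b')
   + a * b * d + a * b' * d' + a' * b * d' + a' * b' * d)%N.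
End Profile.

Section Independents.
Variables (G : mgraph) (c : edge G -> label).
Hypothesis c_missing : mult c (true, true, true) = 0%N.

Lemma independents_profile1 : independents c 1 = profile1 (mult c).
Proof. by rewrite independents1 sum_label c_missing /= /profile1; lia. Qed.

Lemma independents_profile2 : independents c 2 = profile2 (mult c).
Proof.
have := independents2 c; rewrite !sum_label c_missing /=.
rewrite /profile2 => h; apply/eqP.
by rewrite -(eqn_pmul2l (isT : 0 < 2)%N) h; apply/eqP; ring.
Qed.

Lemma independents_profile3 : independents c 3 = profile3 (mult c).
Proof.
have := independents3 c; rewrite !sum_label c_missing.
rewrite /independent3 /= !(muln0, addn0, mul0n, add0n, muln1) /profile3 => h; apply/eqP.
by rewrite -(eqn_pmul2l (isT : 0 < 6)%N) h; apply/eqP; ring.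
Qed.
End Independents.

(** * Maximising the number of spanning trees *)

Section Optimisation.
Import ZArith Psatz.
Local Open Scope Z_scope.

(** The penalty is least when each difference is as small as its parity allows. Of parity, only its
    consequences at the values 0 and 1 are assumed. *)
Lemma odd_pairs_bound_pos (x y z U V W ox oy oz : Z) :
  0 <= U <= x -> 0 <= V <= y -> 0 <= W <= z ->
  0 <= ox <= 1 -> 0 <= oy <= 1 -> 0 <= oz <= 1 ->
  (U = 0 -> ox = 0) -> (V = 0 -> oy = 0) -> (W = 0 -> oz = 0) ->
  (U = 1 -> ox = 1) -> (V = 1 -> oy = 1) -> (W = 1 -> oz = 1) ->
  ox * (y + z) + oy * (x + z) + oz * (x + y) - 2 * ox * oy * oz
    <= U * U * (y + z) + V * V * (x + z) + W * W * (x + y) - 2 * U * V * W.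
Proof.
intros hU hV hW hox hoy hoz U0 V0 W0 U1 V1 W1.
assert (oU : ox <= U * U) by (assert (ox <= U) by lia; nia).
assert (oV : oy <= V * V) by (assert (oy <= V) by lia; nia).
assert (oW : oz <= W * W) by (assert (oz <= W) by lia; nia).
destruct (Z.eq_dec U 0) as [->|nU]; [rewrite (U0 erefl); nia|].
destruct (Z.eq_dec V 0) as [->|nV]; [rewrite (V0 erefl); nia|].
destruct (Z.eq_dec W 0) as [->|nW]; [rewrite (W0 erefl); nia|].
(* This is the case $x=U$, $y=V$, $z=W$. It suffices because the coefficients of $x,y,z$ in the
   difference of the two sides are nonpositive. *)
assert (E : (ox - U * U) * (V + W) + (oy - V * V) * (U + W) + (oz - W * W) * (U + V)
             - 2 * ox * oy * oz + 2 * U * V * W <= 0).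
(* All three odd is the extreme case. After the shift by 1 it reduces to nonnegative terms such as
   $p(r-t)^2$, $p^2$ and $prt$. *)
{ assert (all_odd : (1 - U * U) * (V + W) + (1 - V * V) * (U + W)
             + (1 - W * W) * (U + V) - 2 + 2 * U * V * W <= 0).
  { pose (p := U - 1); pose (r := V - 1); pose (t := W - 1).
    replace U with (p + 1) by (unfold p; lia).
    replace V with (r + 1) by (unfold r; lia).
    replace W with (t + 1) by (unfold t; lia).
    assert (0 <= p) by (unfold p; lia). assert (0 <= r) by (unfold r; lia).
    assert (0 <= t) by (unfold t; lia). clearbody p r t.
    assert (0 <= p * r) by nia. assert (0 <= p * t) by nia. assert (0 <= r * t) by nia.
    assert (sq : forall i j, 0 <= i -> 0 <= i * (j * j))
      by (intros; apply Z.mul_nonneg_nonneg; [assumption | apply Z.square_nonneg]).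
    assert (S1 := sq p (r - t)). assert (S2 := sq r (p - t)). assert (S3 := sq t (r - p)).
    assert (S4 := sq 1 p). assert (S5 := sq 1 r). assert (S6 := sq 1 t).
    assert (0 <= p * r * t) by nia.
    lia. }
  assert (ox = 0 \/ ox = 1) as [->| ->] by lia;
  assert (oy = 0 \/ oy = 1) as [->| ->] by lia;
  assert (oz = 0 \/ oz = 1) as [->| ->] by lia; lia. }
assert ((ox - U * U) * (y + z) <= (ox - U * U) * (V + W)) by nia.
assert ((oy - V * V) * (x + z) <= (oy - V * V) * (U + W)) by nia.
assert ((oz - W * W) * (x + y) <= (oz - W * W) * (U + V)) by nia.
lia.
Qed.

Lemma odd_pairs_bound (x y z u v w ox oy oz : Z) :
  Z.abs u <= x -> Z.abs v <= y -> Z.abs w <= z ->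
  (exists i, u = 2 * i + ox) -> (exists i, v = 2 * i + oy) -> (exists i, w = 2 * i + oz) ->
  0 <= ox <= 1 -> 0 <= oy <= 1 -> 0 <= oz <= 1 ->
  ox * (y + z) + oy * (x + z) + oz * (x + y) - 2 * ox * oy * oz
    <= u * u * (y + z) + v * v * (x + z) + w * w * (x + y) - 2 * u * v * w.
Proof.
intros hu hv hw [i hi] [j hj] [k hk] hox hoy hoz.
assert (H := @odd_pairs_bound_pos x y z (Z.abs u) (Z.abs v) (Z.abs w) ox oy oz).
assert (2 * u * v * w <= 2 * Z.abs u * Z.abs v * Z.abs w).
{ assert (le_abs : u * v * w <= Z.abs (u * v * w)) by lia.
  rewrite !Z.abs_mul in le_abs. lia. }
assert (sq : forall t, Z.abs t * Z.abs t = t * t) by lia.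
rewrite !sq in H.
enough (ox * (y + z) + oy * (x + z) + oz * (x + y) - 2 * ox * oy * oz
    <= u * u * (y + z) + v * v * (x + z) + w * w * (x + y)
       - 2 * Z.abs u * Z.abs v * Z.abs w) by lia.
apply H; lia.
Qed.

(* Four times the maximal number of spanning trees with 6q + r edges. *)
Definition tree_max (q r : Z) : Z :=
  match r with
  | 0 => 64 * q * q * q
  | 1 => 64 * q * q * q + 32 * q * q
  | -1 => 64 * q * q * q - 32 * q * q
  | 2 => 64 * q * q * q + 64 * q * q + 16 * q
  | -2 => 64 * q * q * q - 64 * q * q + 16 * q
  | _ => 64 * q * q * q + 96 * q * q + 40 * q + 4
  end.

(** In the application the pair sums are $T-d$, $T+be$, $T+ga$, and the left-hand side is the
    deviation of their product from $T^3+eT^2$. The inequality $4\,be\,ga\le(e+d)^2$ makes it very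
    negative for $d\ge3$. The bounds $-2T$ and $-T-1$ are the deviations of [tree_max] from
    $T^3+eT^2$ for $r=3$ and $r=2$. *)
Lemma product_far (T e d be ga : Z) :
  be + ga = e + d -> -2 <= e <= 2 -> 3 <= d <= T ->
  - T * d * (e + d) + be * ga * (T - d) <= - 2 * T /\
  - T * d * (e + d) + be * ga * (T - d) <= - T - 1.
Proof.
intros hg he hd.
assert (S1 := Z.square_nonneg (be - ga)).
assert (S2 : 4 * (be * ga) <= (e + d) * (e + d)) by (rewrite <- hg; lia).
assert (S3 : 4 * (be * ga) * (T - d) <= (e + d) * (e + d) * (T - d)).
{ apply Z.mul_le_mono_nonneg_r; lia. }
assert (S4 : 8 <= (e + d) * (3 * d - e)).
{ destruct (Z_le_gt_dec e 0); 
  [apply (Z.mul_le_mono_nonneg 1 _ 8) | apply (Z.mul_le_mono_nonneg 4 _ 2)]; lia. }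
assert (S5 : T * 8 <= T * ((e + d) * (3 * d - e))) by (apply Z.mul_le_mono_nonneg_l; lia).
assert (S6 : 1 * 3 <= (e + d) * (d * (e + d))).
{ apply Z.mul_le_mono_nonneg; try lia; apply (Z.mul_le_mono_nonneg 3 _ 1); lia. }
assert (4 * (- T * d * (e + d) + be * ga * (T - d)) <= - (8 * T + 3)) by lia.
lia.
Qed.

(** With [x] the largest pair sum, [y + z] is the smallest of the three factors, and the argument
    goes by its shortfall from the average factor. Far from balance the product alone is small
    enough; near balance the parity penalty decides. *)
Lemma product_bound_max (q r x y z i j k ox oy oz : Z) :
  -2 <= r <= 3 -> x + y + z = 6 * q + r -> 0 <= y <= x -> 0 <= z <= x ->
  x = 2 * i + ox -> y = 2 * j + oy -> z = 2 * k + oz ->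
  0 <= ox <= 1 -> 0 <= oy <= 1 -> 0 <= oz <= 1 ->
  (x + y) * (y + z) * (z + x)
    - (ox * (y + z) + oy * (x + z) + oz * (x + y) - 2 * ox * oy * oz)
  <= tree_max q r.
Proof.
intros hr hs hy hz hi hj hk hox hoy hoz.
assert (hc : ox * (y + z) + oy * (x + z) + oz * (x + y) - 2 * ox * oy * oz >= 0).
{ assert (ox = 0 \/ ox = 1) as [->| ->] by lia;
  assert (oy = 0 \/ oy = 1) as [->| ->] by lia;
  assert (oz = 0 \/ oz = 1) as [->| ->] by lia; lia. }
(* The three factors add up to $12q+2r=3T+e$ with $T=4q+t$, where $t$ is $2r/3$ rounded towards 0
   and $e=2r-3t$. *)
assert (main : forall t e, (r = 0 /\ t = 0 /\ e = 0) \/ (r = 1 /\ t = 0 /\ e = 2) \/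
    (r = -1 /\ t = 0 /\ e = -2) \/ (r = 2 /\ t = 1 /\ e = 1) \/
    (r = -2 /\ t = -1 /\ e = -1) \/ (r = 3 /\ t = 2 /\ e = 0) ->
  (x + y) * (y + z) * (z + x)
    - (ox * (y + z) + oy * (x + z) + oz * (x + y) - 2 * ox * oy * oz)
  <= tree_max q r).
{ intros t e cases.
  pose (T := 4 * q + t); pose (d := T - (y + z)); pose (be := (x + z) - T).
  assert (0 <= d <= T) by (unfold d, T; lia).
  assert (- d <= be <= e + 2 * d) by (unfold be, d, T; lia).
  assert (y = 2 * q + r - t - be) by (unfold be, d, T; lia).
  assert (x = 2 * q + r - t + d) by (unfold be, d, T; lia).
  assert (z = 2 * q + r - t - e - d + be) by (unfold be, d, T; lia).
  assert (hp : (x + y) * (y + z) * (z + x) = T * T * T + e * (T * T)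
     + (- T * d * (e + d) + be * (e + d - be) * (T - d))).
  { replace (y + z) with (T - d) by (unfold d; lia).
    replace (z + x) with (T + be) by (unfold be; lia).
    replace (x + y) with (T + (e + d - be)) by (unfold be, d, T; lia). ring. }
  destruct (Z_le_gt_dec 3 d) as [far|near].
  - destruct (@product_far T e d be (e + d - be)) as [F1 F2]; [lia | lia | lia |].
    rewrite hp; unfold tree_max, T in *; clear hp.
    destruct cases as [c|[c|[c|[c|[c|c]]]]]; destruct c as [-> [-> ->]]; lia.
  (* Since $-d\le be\le e+2d$ with $d,e\le2$, [be] lies between $-2$ and 6, and finitely many shapes
     remain. *)
  - clearbody d be. clear hp.
    assert (dd : d = 0 \/ d = 1 \/ d = 2) by lia.
    unfold tree_max, T in *.
    destruct cases as [c|[c|[c|[c|[c|c]]]]]; destruct c as [-> [-> ->]];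
    destruct dd as [->|[->| ->]];
    (assert (bb : be = -2 \/ be = -1 \/ be = 0 \/ be = 1 \/ be = 2 \/ be = 3 \/ be = 4
       \/ be = 5 \/ be = 6) by lia);
    repeat (destruct bb as [bb|bb]; [subst be; try lia | ]); try subst be; try lia; 
    subst x y z;
    (assert (ox = 0 \/ ox = 1) as [->| ->] by lia);
    (assert (oy = 0 \/ oy = 1) as [->| ->] by lia);
    (assert (oz = 0 \/ oz = 1) as [->| ->] by lia); lia. }
assert (r = 0 \/ r = 1 \/ r = -1 \/ r = 2 \/ r = -2 \/ r = 3) as
  [c|[c|[c|[c|[c|c]]]]] by lia.
- apply (main 0 0); lia.
- apply (main 0 2); lia.
- apply (main 0 (-2)); lia.
- apply (main 1 1); lia.
- apply (main (-1) (-1)); lia.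
- apply (main 2 0); lia.
Qed.

Definition tree_poly (a a' b b' d d' : Z) : Z :=
  a * a' * (b + b' + d + d') + b * b' * (a + a' + d + d') + d * d' * (a + a' + b + b')
   + a * b * d + a * b' * d' + a' * b * d' + a' * b' * d.

Lemma tree_poly_le (q r a a' b b' d d' : Z) :
  0 <= a -> 0 <= a' -> 0 <= b -> 0 <= b' -> 0 <= d -> 0 <= d' ->
  -2 <= r <= 3 -> a + a' + b + b' + d + d' = 6 * q + r ->
  4 * tree_poly a a' b b' d d' <= tree_max q r.
Proof.
intros ha ha' hb hb' hd hd' hr hs.
pose (x := a + a'); pose (y := b + b'); pose (z := d + d').
(* The left-hand side is the determinant of a symmetric matrix with diagonal
   y + z, x + z, x + y and off-diagonal entries a - a', b - b', d - d'. *)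
assert (hdet : 4 * tree_poly a a' b b' d d' = (x + y) * (y + z) * (z + x)
   - ((a - a') * (a - a') * (y + z) + (b - b') * (b - b') * (x + z)
      + (d - d') * (d - d') * (x + y) - 2 * (a - a') * (b - b') * (d - d'))).
{ unfold tree_poly, x, y, z; ring. }
assert (parity : forall t, exists i o, t = 2 * i + o /\ 0 <= o <= 1).
{ intro t; exists (t / 2), (t mod 2).
  assert (P1 := Z.div_mod t 2). assert (P2 := Z.mod_pos_bound t 2). lia. }
destruct (parity x) as [i [ox [hi hox]]].
destruct (parity y) as [j [oy [hj hoy]]].
destruct (parity z) as [k [oz [hk hoz]]].
assert (B : ox * (y + z) + oy * (x + z) + oz * (x + y) - 2 * ox * oy * oz <=
   (a - a') * (a - a') * (y + z) + (b - b') * (b - b') * (x + z)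
      + (d - d') * (d - d') * (x + y) - 2 * (a - a') * (b - b') * (d - d')).
{ apply odd_pairs_bound; try lia.
  - exists (i - a'); unfold x in *; lia.
  - exists (j - b'); unfold y in *; lia.
  - exists (k - d'); unfold z in *; lia. }
assert (hx : 0 <= x) by (unfold x; lia). assert (hy : 0 <= y) by (unfold y; lia).
assert (hz : 0 <= z) by (unfold z; lia).
assert (hs' : x + y + z = 6 * q + r) by (unfold x, y, z; lia).
clearbody x y z; rewrite hdet; clear hdet.
(* The expressions are symmetric in the three pairs, so the largest pair sum can be moved to the
   first place. *)
destruct (Z_le_gt_dec y x); destruct (Z_le_gt_dec z x); destruct (Z_le_gt_dec z y).
all: first
  [ assert (M := @product_bound_max q r x y z i j k ox oy oz); lia
  | assert (M := @product_bound_max q r y x z j i k oy ox oz); lia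
  | assert (M := @product_bound_max q r z y x k j i oz oy ox); lia ].
Qed.
End Optimisation.

(** * Profiles and arrangements of the longer chains *)

Definition weight (beta : label -> bool) : nat :=
  (beta (true, false, false) + beta (false, true, true) + beta (false, true, false)
   + beta (true, false, true) + beta (false, false, true) + beta (true, true, false))%N.

(** For weight 2 or 4, the two exceptional edges (longer or shorter) form an opposite pair, that is,
    a perfect matching of $K_4$. For weight 3, an opposite pair together with any third edge is a
    path. *)
Definition good_pattern (beta : label -> bool) : bool :=
  let a := beta (true, false, false) in let a' := beta (false, true, true) in
  let b := beta (false, true, false) in let b' := beta (true, false, true) in
  let d := beta (false, false, true) in let d' := beta (true, true, false) in
  if weight beta \in [:: 2; 4]%N then [&& a == a', b == b' & d == d']
  else (weight beta == 3)%N ==> [|| a && a', b && b' | d && d'].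

Definition matches (q : nat) (beta : label -> bool) (l : label -> nat) : Prop :=
  forall u, u != 0 -> u != (true, true, true) -> l u = (q + beta u)%N.

(* [tree_max / 4], with the remainder k in 0..5 in place of r in -2..3. *)
Definition tree_max_nat (q k : nat) : nat :=
  nth 0%N [:: 16 * q * q * q; 16 * q * q * q + 8 * q * q; 16 * q * q * q + 16 * q * q + 4 * q;
    16 * q * q * q + 24 * q * q + 10 * q + 1; 16 * q * q * q + 32 * q * q + 20 * q + 4;
    16 * q * q * q + 40 * q * q + 32 * q + 8]%N k.

Lemma profile3_le q k l : (k < 6)%N -> profile1 l = (6 * q + k)%N ->
  (profile3 l <= tree_max_nat q k)%N.
Proof.
rewrite /profile1 /profile3 => k6.
move: (l _) (l _) (l _) (l _) (l _) (l _) => d' d b' b a' a sl.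
have nn x : BinInt.Z.le BinNums.Z0 (BinInt.Z.of_nat x) by lia.
have h q' r' := @tree_poly_le q' r' (BinInt.Z.of_nat a) (BinInt.Z.of_nat a')
  (BinInt.Z.of_nat b) (BinInt.Z.of_nat b')
  (BinInt.Z.of_nat d) (BinInt.Z.of_nat d') (nn _) (nn _) (nn _) (nn _) (nn _) (nn _).
rewrite /tree_poly in h.
case: k k6 sl => [|[|[|[|[|[|//]]]]]] _ sl; rewrite /tree_max_nat /=.
- have := h (BinInt.Z.of_nat q) BinNums.Z0 ltac:(lia) ltac:(lia).
  by rewrite /tree_max; cbv beta iota; lia.
- have := h (BinInt.Z.of_nat q) (BinNums.Zpos BinNums.xH) ltac:(lia) ltac:(lia).
  by rewrite /tree_max; cbv beta iota; lia.
- have := h (BinInt.Z.of_nat q) (BinNums.Zpos (BinNums.xO BinNums.xH)) ltac:(lia) ltac:(lia).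
  by rewrite /tree_max; cbv beta iota; lia.
- have := h (BinInt.Z.of_nat q) (BinNums.Zpos (BinNums.xI BinNums.xH)) ltac:(lia) ltac:(lia).
  by rewrite /tree_max; cbv beta iota; lia.
(* Remainders 4 and 5 are $r=-2$ and $r=-1$ relative to $q+1$. *)
- have := h (BinInt.Z.of_nat q.+1) (BinNums.Zneg (BinNums.xO BinNums.xH)) ltac:(lia) ltac:(lia).
  by rewrite /tree_max; cbv beta iota; lia.
- have := h (BinInt.Z.of_nat q.+1) (BinNums.Zneg BinNums.xH) ltac:(lia) ltac:(lia).
  by rewrite /tree_max; cbv beta iota; lia.
Qed.

Lemma profile1_matches q beta l : matches q beta l -> profile1 l = (6 * q + weight beta)%N.
Proof. by move=> hl; rewrite /profile1 !hl // /weight; lia. Qed.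

(** The exceptional disjunct is needed for ties at $q=0$: three independent labels from three
    different opposite pairs also give the value 1. There are then at most three edges. *)
Lemma profile3_matches q beta l : matches q beta l -> (weight beta < 6)%N ->
  if good_pattern beta then profile3 l = tree_max_nat q (weight beta)
  else (q = 0 /\ weight beta <= 3)%N \/ (profile3 l < tree_max_nat q (weight beta))%N.
Proof.
move=> hl; rewrite /profile3 !hl // /good_pattern /weight.
do 6 case: (beta _); rewrite ?inE //= => _; rewrite /tree_max_nat /=; lia.
Qed.

(** This is $(x-q)(x-q-1)\ge0$ with its equality case, written without subtraction. *)
Lemma gap_sqr (q x : nat) : ((2 * q + 1) * x <= x * x + q * (q + 1))%N /\
  ((2 * q + 1) * x = x * x + q * (q + 1) -> x = q \/ x = q.+1)%N.
Proof.
case: (leqP x q) => h.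
  have [i ->] : exists i, q = (x + i)%N by exists (q - x)%N; lia.
  split; first nia.
  by move=> e; left; nia.
have [i ->] : exists i, x = (q + 1 + i)%N by exists (x - q.+1)%N; lia.
split; first nia.
by move=> e; right; nia.
Qed.

(** Two distinct nonzero labels are always independent, so $2N_2$ is the square of the sum minus the
    sum of squares; the latter is bounded by adding [gap_sqr] over the six labels. *)
Lemma profile2_le q k l : profile1 l = (6 * q + k)%N ->
  (2 * profile2 l + (6 * q * q + k * (2 * q + 1)) <= (6 * q + k) * (6 * q + k))%N /\
  ((2 * profile2 l + (6 * q * q + k * (2 * q + 1)) = (6 * q + k) * (6 * q + k))%N ->
   exists beta, matches q beta l).
Proof.
move=> sl; rewrite -sl.
have [A1 A2] := gap_sqr q (l (true, false, false)).
have [B1 B2] := gap_sqr q (l (false, true, true)).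
have [C1 C2] := gap_sqr q (l (false, true, false)).
have [D1 D2] := gap_sqr q (l (true, false, true)).
have [E1 E2] := gap_sqr q (l (false, false, true)).
have [F1 F2] := gap_sqr q (l (true, true, false)).
have slq : ((2 * q + 1) * profile1 l = (2 * q + 1) * (6 * q + k))%N by rewrite sl.
split; first by move: slq; rewrite /profile1 /profile2; lia.
move=> eql; exists (fun u => l u == q.+1).
have {A1 A2} A : l (true, false, false) = q \/ l (true, false, false) = q.+1.
  by apply: A2; move: slq eql; rewrite /profile1 /profile2; lia.
have {B1 B2} B : l (false, true, true) = q \/ l (false, true, true) = q.+1.
  by apply: B2; move: slq eql; rewrite /profile1 /profile2; lia.
have {C1 C2} C : l (false, true, false) = q \/ l (false, true, false) = q.+1.
  by apply: C2; move: slq eql; rewrite /profile1 /profile2; lia.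
have {D1 D2} D : l (true, false, true) = q \/ l (true, false, true) = q.+1.
  by apply: D2; move: slq eql; rewrite /profile1 /profile2; lia.
have {E1 E2} E : l (false, false, true) = q \/ l (false, false, true) = q.+1.
  by apply: E2; move: slq eql; rewrite /profile1 /profile2; lia.
have {F1 F2} F : l (true, true, false) = q \/ l (true, true, false) = q.+1.
  by apply: F2; move: slq eql; rewrite /profile1 /profile2; lia.
by move=> [[[] []] []] // _ _ /=; lia.
Qed.

Lemma profile2_matches q beta l : matches q beta l ->
  (2 * profile2 l + (6 * q * q + weight beta * (2 * q + 1))
   = (6 * q + weight beta) * (6 * q + weight beta))%N.
Proof.
move=> hl; rewrite /profile2 !hl // /weight.
by do 6 case: (beta _) => /=; lia.
Qed.

Definition optimal_profile (q : nat) (l : label -> nat) : Prop :=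
  exists beta, [/\ matches q beta l, good_pattern beta & (weight beta < 6)%N].

(** The alternative of at most three edges absorbs the ties at $q=0$. *)
Lemma optimal_profile_max q l l' : optimal_profile q l -> (profile1 l' <= profile1 l)%N ->
  [/\ (profile2 l' <= profile2 l)%N, (profile3 l' <= profile3 l)%N &
      profile1 l' = profile1 l -> profile2 l' = profile2 l -> profile3 l' = profile3 l ->
      (profile1 l <= 3)%N \/ optimal_profile q l'].
Proof.
move=> [beta [hl good w6]] l'l.
have P1 := profile1_matches hl; have P2 := profile2_matches hl.
have := profile3_matches hl w6; rewrite good => P3.
(* The [t] edges by which [l'] falls short are added to one chain. This lowers neither of the other
   two counts and makes the totals equal, so the bounds for a fixed total apply. *)
pose t := (profile1 l - profile1 l')%N.
pose m u := if u == (true, false, false) then (l' u + t)%N else l' u.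
have m1 : profile1 m = (6 * q + weight beta)%N.
  by rewrite -P1 /profile1 /m /= /t /profile1; rewrite /profile1 in l'l; lia.
have m2 : (profile2 l' <= profile2 m)%N by rewrite /profile2 /m /=; nia.
have m3 : (profile3 l' <= profile3 m)%N by rewrite /profile3 /m /=; nia.
have [Q2 Q2'] := profile2_le m1.
have Q3 := profile3_le w6 m1.
split; [lia | lia |] => e1 e2 e3.
have {m1 m2 m3 Q2 Q2' Q3} l'1 : profile1 l' = (6 * q + weight beta)%N by rewrite e1.
have [_ [|beta' hl']] := profile2_le l'1; first by rewrite e2.
have wE : weight beta' = weight beta.
  by have := profile1_matches hl'; rewrite l'1; lia.
have w6' : (weight beta' < 6)%N by rewrite wE.
have := profile3_matches hl' w6'; case: ifP => good' => [_|]; last rewrite wE => P3'.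
  by right; exists beta'.
by left; rewrite P1; case: P3' => [[-> w3]|]; last rewrite e3 P3; lia.
Qed.

Definition linear_label (p q r u : label) : label := (ldot p u, ldot q u, ldot r u).

Lemma ldotD w u v : ldot w (u + v) = ldot w u (+) ldot w v.
Proof.
by case: w => [[[] []] []]; case: u => [[[] []] []]; case: v => [[[] []] []].
Qed.

Lemma linear_labelD p q r : {morph linear_label p q r : u v / u + v}.
Proof. by move=> u v; rewrite /linear_label !ldotD. Qed.

(** One arrangement is chosen for each weight. Under [K4_label] below, the one for weight 3 is the
    path through the vertices 0, 1, 2, 3. *)
Definition standard_pattern (k : nat) (u : label) : bool :=
  match k with
  | 0 => false
  | 1 => u == (true, false, false)
  | 2 => u \in [:: (true, false, false); (false, true, true)]
  | 3 => u \in [:: (true, false, false); (false, true, true); (false, false, true)]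
  | 4 => u \notin [:: (true, false, false); (false, true, true)]
  | _ => u != (true, false, false)
  end.

Definition labels : seq label :=
  [seq (x, z) | x <- [seq (x, y) | x <- [:: true; false], y <- [:: true; false]],
                z <- [:: true; false]].

Lemma mem_labels u : u \in labels.
Proof. by case: u => [[[] []] []]. Qed.

Definition standardises (a a' b b' d d' : bool) (k : nat) (p q r : label) : bool :=
  let f := linear_label p q r in
  [&& all (fun u => (f u == (false, false, false)) ==> (u == (false, false, false))) labels,
   f (true, true, true) == (true, true, true),
   a == standard_pattern k (f (true, false, false)),
   a' == standard_pattern k (f (false, true, true)),
   b == standard_pattern k (f (false, true, false)),
   b' == standard_pattern k (f (true, false, true)),
   d == standard_pattern k (f (false, false, true))
   & d' == standard_pattern k (f (true, true, false))].

(* The permutations of the four vertices of K4 act on the labels as the linear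
   maps fixing the missing label, so it is enough to search those. *)
Lemma standard_patternP (beta : label -> bool) :
  good_pattern beta -> (weight beta < 6)%N ->
  exists phi : label -> label,
    [/\ {morph phi : u v / u + v}, injective phi, phi (true, true, true) = (true, true, true)
      & forall u, u != 0 -> u != (true, true, true) ->
          beta u = standard_pattern (weight beta) (phi u)].
Proof.
move=> good w6.
(* A linear map fixes [(true, true, true)] exactly when each of its rows has an odd number of
   ones. *)
pose odds := [:: (true, false, false); (false, true, false); (false, false, true);
                 (true, true, true)].
have : has (fun p => has (fun q => has (standardises
   (beta (true, false, false)) (beta (false, true, true)) (beta (false, true, false))
   (beta (true, false, true)) (beta (false, false, true)) (beta (true, true, false))
   (weight beta) p q) odds) odds) odds.
  move: good w6; rewrite /good_pattern /weight; move: (beta _) (beta _) (beta _).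
  move: (beta _) (beta _) (beta _).
  by do 6 case; rewrite ?inE //= => _ _; vm_compute.
case/hasP=> p _ /hasP[q _ /hasP[r _]].
case/and4P=> /allP ker /eqP fix1 /eqP e1 /and5P[/eqP e2 /eqP e3 /eqP e4 /eqP e5 /eqP e6].
exists (linear_label p q r); split=> // [|u v euv|].
- exact: linear_labelD.
- apply/eqP; rewrite -label_add_eq0; apply: (implyP (ker _ (mem_labels _))).
  by rewrite linear_labelD euv label_addxx.
by case=> [[[] []] []].
Qed.

Lemma mult_comp (G : mgraph) (c : edge G -> label) (phi : label -> label) u :
  injective phi -> mult (phi \o c) (phi u) = mult c u.
Proof. by move=> inj; apply: eq_card => e; rewrite !inE /= (inj_eq inj). Qed.

(** Replacing the pattern by the standard one of its weight lets two optimal graphs be compared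
    label by label. *)
Lemma optimal_labelling (G : mgraph) (c : edge G -> label) q :
  labelling c -> (forall e, c e != 0) -> mult c (true, true, true) = 0%N ->
  optimal_profile q (mult c) ->
  exists (d : edge G -> label) (k : nat), [/\ labelling d, forall e, d e != 0, (k < 6)%N &
    [/\ #|edge G| = (6 * q + k)%N, mult d (true, true, true) = 0%N
      & matches q (standard_pattern k) (mult d)]].
Proof.
move=> labc c0 c1 [beta [mc good w6]].
have [phi [phiD phi_inj phi1 phiE]] := standard_patternP good w6.
have phi0 : phi 0 = 0 by apply: (addrI (phi 0)); rewrite -phiD !addr0.
exists (phi \o c), (weight beta); split=> //.
- exact: labelling_comp.
- by move=> e; rewrite /= -phi0 (inj_eq phi_inj).
split; last 1 first.
- move=> u u0 u1.
  have /codomP[v eu] : u \in codom phi by apply: (inj_card_onto phi_inj).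
  rewrite {}eu in u0 u1 *; rewrite mult_comp // -phiE.
  + by apply: mc; [rewrite -(inj_eq phi_inj) phi0 | rewrite -(inj_eq phi_inj) phi1].
  + by rewrite -(inj_eq phi_inj) phi0.
  + by rewrite -(inj_eq phi_inj) phi1.
- rewrite (card_edge_mult c) sum_label c1.
  have -> : mult c (false, false, false) = 0%N.
    by apply: eq_card0 => e; rewrite !inE; exact: negbTE (c0 e).
  by rewrite -(profile1_matches mc) /profile1; lia.
- by rewrite -phi1 mult_comp.
Qed.

(** * Reconstructing a graph from its labels *)

Section StarIsomorphism.
Variables (G H : mgraph) (f : vertex G -> vertex H) (g : edge G -> edge H).
Hypotheses (f_bij : bijective f) (g_bij : bijective g).
Hypothesis stars : forall v e, (e \in cut [set v]) = (g e \in cut [set f v]).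
Hypothesis loopless : forall e : edge G, src e != tgt e.

(** In a loopless graph the ends of an edge are the two vertices whose stars contain it. *)
Lemma isomorphic_of_stars : isomorphic G H.
Proof.
exists f, g; split=> // e; have ne := loopless e.
have fne : f (src e) != f (tgt e) by rewrite (inj_eq (bij_inj f_bij)).
have := stars (src e) e; have := stars (tgt e) e; rewrite !inE !eqxx (negbTE ne).
rewrite [tgt e == src e]eq_sym (negbTE ne) /joins /=.
case: (eqVneq (src (g e)) (f (src e))) => [->|_] /=.
  by rewrite (negbTE fne) /= => <-.
case: (eqVneq (tgt (g e)) (f (src e))) => [->|_] //=.
by rewrite (negbTE fne) addbF andbT => <-.
Qed.
End StarIsomorphism.

Lemma loopless_of_stars (G : mgraph) :
  (2 * #|edge G| <= \sum_(v : vertex G) #|cut [set v]|)%N ->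
  forall e : edge G, src e != tgt e.
Proof.
rewrite sum_card_star leq_mul2l /= => h e.
have nT : [set e : edge G | src e != tgt e] = setT.
  by apply/eqP; rewrite eqEcard subsetT cardsT.
by have := in_setT e; rewrite -nT inE.
Qed.

Lemma sum_eq_pointwise (T : finType) (f g : T -> nat) :
  (forall x, f x <= g x)%N -> (\sum_x g x <= \sum_x f x)%N -> forall x, f x = g x.
Proof.
move=> fg; have le : (\sum_x f x <= \sum_x g x)%N by apply: leq_sum => x _; exact: fg.
have /leqif_sum [_] : forall x, true -> (f x <= g x ?= iff (f x == g x))%N.
  by move=> x _; split.
move=> E gf x; move: E; rewrite eqn_leq le gf => /esym/forallP/(_ x) /=.
by move/eqP.
Qed.

(** An edge inside [X] lies in two of the stars and cancels in $F_2$. *)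
Lemma sum_cut (G : mgraph) (F : edge G -> bool) (X : {set vertex G}) :
  \sum_(e in cut X) F e = \sum_(v in X) \sum_(e in cut [set v]) F e.
Proof.
transitivity (\sum_(v in X) \sum_e ((e \in cut [set v] : bool) * F e)); last first.
  apply: eq_bigr => v _; rewrite [RHS]big_mkcond; apply: eq_bigr => e _.
  by case: (e \in cut _); rewrite ?mul1r ?mul0r.
rewrite exchange_big /= big_mkcond; apply: eq_bigr => e _.
rewrite -mulr_suml.
have -> : \sum_(v in X) (e \in cut [set v] : bool) = (e \in cut X).
  transitivity (\sum_(v in X) ((src e == v : bool) + (tgt e == v : bool))).
    by apply: eq_bigr => v _; rewrite !inE.
  by rewrite big_split /= !sum_eq_in inE.
by case: (e \in cut X); rewrite ?mul1r ?mul0r.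
Qed.

(* The types [w] of the four branch vertices: the three edges leaving such a
   vertex carry the three labels of [line w]. *)
Definition odd_label : pred label := fun w => ldot w (true, true, true).

(** A line of the Fano plane when [w] is nonzero; for odd [w] it avoids the missing label. *)
Definition line (w : label) : {set label} :=
  [set u | (u != (false, false, false)) && ~~ ldot w u].

Definition K4_labelled (G : mgraph) (c : edge G -> label) : Prop :=
  [/\ (0 < #|vertex G|)%N, cut_connected G, labelling c,
      forall e, c e != 0 & forall e, c e != (true, true, true)] /\
  (forall u, u != 0 -> u != (true, true, true) -> exists e, c e = u).

Definition star_type (G : mgraph) (c : edge G -> label) (v : vertex G) (w : label) : Prop :=
  #|cut [set v]| = 3%N /\ c @: cut [set v] = line w.

Lemma line_inj w w' : odd_label w -> odd_label w' -> line w = line w' -> w = w'.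
Proof.
move=> ow ow' /setP h.
move: (h (true, false, false)) (h (false, true, false)) (h (false, false, true)) ow ow'.
by rewrite !inE /odd_label; case: w h => [[[] []] []] _; case: w' => [[[] []] []].
Qed.

Lemma line_of_triple (x y z : label) :
  x != 0 -> y != 0 -> z != 0 -> x != y -> x != z -> y != z -> x != (true, true, true) ->
  y != (true, true, true) -> z != (true, true, true) -> x + y + z = 0 ->
  exists2 w, odd_label w & [set x; y; z] = line w.
Proof.
move=> x0 y0 z0 xy xz yz x1 y1 z1 /eqP; rewrite label_add_eq0 => /eqP ez.
have : has (fun w => odd_label w && all (fun u => ((u == x) || (u == y) || (u == z))
    == ((u != (false, false, false)) && ~~ ldot w u)) labels) labels.
  by move: x0 y0 z0 xy xz yz x1 y1 z1; rewrite -ez; case: x ez => [[[] []] []] _;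
     case: y => [[[] []] []].
case/hasP=> w _ /andP[ow /allP h]; exists w => //.
by apply/setP=> u; rewrite !inE; apply/eqP/h/mem_labels.
Qed.

Lemma labels_spanning (G : mgraph) (c : edge G -> label) :
  (forall u, u != 0 -> u != (true, true, true) -> exists e, c e = u) -> label_spanning c.
Proof.
move=> onto w hw.
by apply: ldot_eq0; [case: (onto (true, false, false)) |
    case: (onto (false, true, false)) | case: (onto (false, false, true))] => // f <-.
Qed.

(** * Injective labellings: the graph has the shape of $K_4$ *)

Section Simple.
Variables (G : mgraph) (c : edge G -> label).
Hypotheses (K4c : K4_labelled c) (c_inj : injective c).

Lemma simple_card : #|edge G| = 6%N /\ #|vertex G| = 4%N.
Proof.
case: K4c => [[n0 conG labc c0 c1] onto].
have spc := labels_spanning onto.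
have e6 := simple_card_edge conG labc c0 c_inj spc n0.
have nE := labelling_card n0 conG spc labc.
suff : (6 <= #|edge G|)%N by lia.
have <- : #|~: [set (false, false, false); (true, true, true)]| = 6%N :> nat.
  by have := cardsC [set (false, false, false); (true, true, true)];
    rewrite cards2 !card_prod card_bool /=; lia.
rewrite -cardsT; apply: leq_trans (leq_imset_card c _).
apply: subset_leq_card; apply/subsetP=> u; rewrite !inE negb_or => /andP[u0 u1].
by have [e <-] := onto u u0 u1; apply: imset_f.
Qed.

(** Four stars of at least three edges already use up $12=2\cdot6$. *)
Lemma simple_card_star v : #|cut [set v : vertex G]| = 3%N.
Proof.
case: K4c => [[n0 conG labc c0 c1] onto]; have [e6 v4] := simple_card.
have h := @sum_eq_pointwise (vertex G) (fun=> 3%N) (fun v => #|cut [set v]|).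
apply/esym/h => [x|]; first by apply: (card_star_gt2 conG labc c0); rewrite ?v4.
apply: leq_trans (sum_card_star_le G) _; rewrite sum_nat_const e6.
by rewrite -[#|xpredT|]/#|vertex G| v4.
Qed.

Lemma simple_star_type v : exists2 w, odd_label w & star_type c v w.
Proof.
case: K4c => [[n0 conG labc c0 c1] onto].
have s3 := simple_card_star v.
have : (0 < #|cut [set v]|)%N by rewrite s3.
case/card_gt0P=> x xS; have /cards2P[y [z [yz eS]]] : (#|cut [set v] :\ x| == 2)%N.
  by have := cardsD1 x (cut [set v]); rewrite xS s3; lia.
have {}eS : cut [set v] = [set x; y; z] by rewrite -setUA -eS setD1K.
have [xy xz] : x != y /\ x != z.
  have := s3; rewrite eS -setUA cardsU1 cards2 yz !inE negb_or.
  by case: (x != y); case: (x != z).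
have := sum_star labc v; rewrite eS -setUA big_setU1 ?inE ?negb_or ?xy ?xz //=.
rewrite big_setU1 ?inE //= big_set1 addrA => sum0.
have [|||||||||w ow eL] := @line_of_triple (c x) (c y) (c z) _ _ _ _ _ _ _ _ _ sum0;
  rewrite ?(inj_eq c_inj) //.
exists w => //; split=> //; rewrite -eL eS.
by rewrite !imsetU !imset_set1.
Qed.
End Simple.

Lemma card_odd_label : #|[set w | odd_label w]| = 4%N.
Proof. by rewrite -sum1dep_card big_mkcond sum_label. Qed.

Lemma card_line w : odd_label w -> #|line w| = 3%N.
Proof. by rewrite -sum1dep_card big_mkcond sum_label /=; case: w => [[[] []] []]. Qed.

Lemma simple_type_uniq (G : mgraph) (c : edge G -> label) v v' w :
  K4_labelled c -> injective c -> star_type c v w -> star_type c v' w -> v = v'.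
Proof.
move=> K4c c_inj [_ ew] [_]; rewrite -ew => /(imset_inj c_inj) e.
have [_ v4] := simple_card K4c c_inj; case: K4c => [[n0 conG labc c0 c1] onto].
case: (cut_inj conG e) => [/set1_inj //|h].
by have := cardsC [set v']; rewrite -h !cards1 v4.
Qed.

(** The type is an injective map from the four vertices to the four odd labels. *)
Lemma simple_type_onto (G : mgraph) (c : edge G -> label) w :
  K4_labelled c -> injective c -> odd_label w -> exists v, star_type c v w.
Proof.
move=> K4c c_inj ow.
pose tau v := odflt 0 [pick w | odd_label w && (c @: cut [set v] == line w)].
have tauP v : odd_label (tau v) /\ star_type c v (tau v).
  rewrite /tau; case: pickP => [w' /andP[ow' /eqP e]|/= no].
    by split=> //; split=> //; exact: simple_card_star K4c c_inj v.
  by have [w' ow' [_ e]] := simple_star_type K4c c_inj v; have := no w'; rewrite ow' e eqxx.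
have tau_inj : injective tau.
  by move=> v v' e; apply: (simple_type_uniq K4c c_inj (tauP v).2); rewrite e; exact: (tauP v').2.
have : w \in [set tau v | v : vertex G].
  suff -> : [set tau v | v : vertex G] = [set w | odd_label w] by rewrite inE.
  apply/eqP; rewrite eqEcard card_odd_label card_imset // (simple_card K4c c_inj).2 leqnn andbT.
  by apply/subsetP=> _ /imsetP[v _ ->]; rewrite inE; exact: (tauP v).1.
by case/imsetP=> v _ ->; exists v; exact: (tauP v).2.
Qed.

(** * Branch vertices and chains in the general case *)

Section Structure.
Variables (G : mgraph) (c : edge G -> label).
Hypothesis K4c : K4_labelled c.

Let D := contract (~: representatives c).
Let cD : edge D -> label := c \o val.

Lemma representatives_K4 : K4_labelled cD.
Proof.
case: K4c => [[n0 conG labc c0 c1] onto]; split.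
  split=> [|||e|e].
  - by case/card_gt0P: n0 => x _; apply/card_gt0P; exists (contract_proj (~: representatives c) x).
  - exact: cut_connected_contract.
  - exact: labelling_contract.
  - exact: c0.
  - exact: c1.
move=> u u0 u1; have [e eu] := onto u u0 u1.
by rewrite -eu; apply: representatives_onto; rewrite eu.
Qed.

Let K4D := representatives_K4.
Let D_inj : injective cD := @representatives_inj G c.

Lemma K4_card : #|edge G| = (#|vertex G| + 2)%N.
Proof.
case: K4c => [[n0 conG labc c0 c1] onto].
exact: labelling_card n0 conG (labels_spanning onto) labc.
Qed.

Lemma K4_card_gt1 : (1 < #|vertex G|)%N.
Proof.
have [e6 _] := simple_card K4D D_inj; have := K4_card.
have : (#|edge D| <= #|edge G|)%N by apply: (leq_card val); exact: val_inj.
by rewrite e6; lia.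
Qed.

(** This is additive over vertices and vanishes at a vertex of degree two, whose two edges share
    their label. So only branch vertices contribute. *)
Let parity (u : label) (X : {set vertex G}) : bool := \sum_(e in cut X) (c e == u : bool).

Lemma parity_sum u X : parity u X = \sum_(v in X) parity u [set v].
Proof. exact: sum_cut. Qed.

Lemma parity_even v u : #|cut [set v : vertex G]| = 2%N -> parity u [set v] = false.
Proof.
case: K4c => [[n0 conG labc c0 c1] onto] /(card_star2 labc) [e [f [ef eS cef]]].
by rewrite /parity eS big_setU1 ?inE //= big_set1 cef; case: (c f == u).
Qed.

Lemma parity_injective X u : {in cut X &, injective c} -> parity u X = (u \in c @: cut X).
Proof.
move=> inj; apply/idP/imsetP => [|[e eX ->]].
  case: (boolP [exists e in cut X, c e == u]) => [/exists_inP[e eX /eqP <-]|].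
    by exists e.
  by move/exists_inPn=> no; rewrite /parity big1 // => e eX; apply/negbTE; exact: no.
rewrite /parity (bigD1 e) //= eqxx big1 // => f /andP[fX fe].
by apply: contraNF fe => /eqP/inj->.
Qed.

Let class (C : vertex D) : {set vertex G} := contract_proj (~: representatives c) @^-1: [set C].

Lemma cut_class C : cut (class C) = val @: cut [set C].
Proof. by rewrite cut_contract. Qed.

Lemma parity_class C w u : star_type cD C w -> parity u (class C) = (u \in line w).
Proof.
move=> [_ <-]; rewrite parity_injective ?cut_class.
  by congr (_ \in _); rewrite -imset_comp.
by move=> _ _ /imsetP[e eC ->] /imsetP[f fC ->] /D_inj ->.
Qed.

Lemma star_ge2 v : (2 <= #|cut [set v : vertex G]|)%N.
Proof.
case: K4c => [[n0 conG labc c0 c1] onto].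
exact: card_star_gt1 conG labc c0 v K4_card_gt1.
Qed.

(** The cut of a class has odd parity at the labels of its line, so not all its vertices have degree
    two. *)
Lemma class_branch C : exists v, (v \in class C) && (2 < #|cut [set v]|)%N.
Proof.
case: (boolP [exists v in class C, 2 < #|cut [set v]|]%N).
  by case/existsP=> v; exists v.
move=> /exists_inPn no; have [w ow st] := simple_star_type K4D D_inj C.
have [u uw] : exists u, u \in line w.
  by apply/card_gt0P; rewrite card_line.
have := parity_class u st; rewrite uw parity_sum big1 // => v vC.
apply: parity_even; apply/eqP; rewrite eqn_leq star_ge2 andbT leqNgt.
exact: no.
Qed.

Definition branch (C : vertex D) : vertex G := xchoose (class_branch C).

Lemma branchP C : branch C \in class C /\ (2 < #|cut [set branch C]|)%N.
Proof. exact/andP/(xchooseP (class_branch C)). Qed.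

Lemma branch_inj : injective branch.
Proof.
move=> C C' e; have := (branchP C).1; have := (branchP C').1.
by rewrite -e !inE => /eqP<- /eqP.
Qed.

Lemma sum_branch : (\sum_(v : vertex G) (2 + (v \in codom branch)) = 2 * #|edge G|)%N.
Proof.
have [_ v4] := simple_card K4D D_inj.
rewrite big_split /= (_ : \sum_(v : vertex G) 2 = #|vertex G| * 2)%N ?sum_nat_const //.
rewrite (_ : \sum_v (v \in codom branch) = 4)%N; first by rewrite K4_card; lia.
by rewrite -big_mkcond sum1_card card_codom //; exact: branch_inj.
Qed.

(** The lower bounds, 2 everywhere and 3 at the four branch vertices, already add up to
    $2|V|+4=2|E|$, so all are equalities. *)
Lemma card_star v : #|cut [set v]| = (2 + (v \in codom branch))%N.
Proof.
apply/esym/(@sum_eq_pointwise _ (fun v => 2 + (v \in codom branch))%N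
   (fun v => #|cut [set v]|)) => {v} [v|].
  case: (boolP (v \in _)) => [/codomP[C ->]|_]; first exact: (branchP C).2.
  by rewrite addn0 star_ge2.
by rewrite sum_branch sum_card_star_le.
Qed.

Lemma K4_loopless (e : edge G) : src e != tgt e.
Proof.
apply: loopless_of_stars.
by rewrite (eq_bigr _ (fun v _ => card_star v)) sum_branch.
Qed.

(** The other vertices of the class have degree two, so the branch vertex has the parities of the
    whole class. The three odd labels fill its three edges. *)
Lemma branch_star_type C w : star_type cD C w -> star_type c (branch C) w.
Proof.
move=> st; have [_ eD] := st; have s3 : #|cut [set branch C]| = 3%N.
  by rewrite card_star codom_f.
split=> //; apply/esym/eqP; rewrite eqEcard.
have ow : #|line w| = 3%N.
  by rewrite -eD (card_imset _ D_inj) (simple_card_star K4D D_inj).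
rewrite ow (leq_trans (leq_imset_card _ _)) ?s3 // andbT.
apply/subsetP=> u uw; have := parity_class u st; rewrite uw parity_sum.
rewrite (bigD1 (branch C)) ?(branchP C).1 //= [X in _ + X]big1 ?addr0.
  move=> pu; apply/imsetP; move: pu; rewrite /parity.
  case: (boolP [exists e in cut [set branch C], c e == u]).
    by case/exists_inP=> e eS /eqP <-; exists e.
  move/exists_inPn=> no; rewrite big1 // => e eS.
  by apply/negbTE; exact: no.
move=> v /andP[vC vb]; apply: parity_even; rewrite card_star.
case: codomP => // -[C' ev]; case/eqP: vb; rewrite ev; congr branch.
have := (branchP C').1; rewrite -ev; move: vC.
by rewrite !inE => /eqP-> /eqP.
Qed.

Lemma K4_star v : #|cut [set v]| = 2%N \/ exists2 w, odd_label w & star_type c v w.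
Proof.
case: (boolP (v \in codom branch)) => [/codomP[C ->]|nb]; last first.
  by left; rewrite card_star (negbTE nb).
right; have [w ow st] := simple_star_type K4D D_inj C.
by exists w => //; exact: branch_star_type.
Qed.

Lemma star_type_onto w : odd_label w -> exists v, star_type c v w.
Proof.
move=> ow; have [C st] := simple_type_onto K4D D_inj ow.
by exists (branch C); exact: branch_star_type.
Qed.

Lemma star_type_uniq v v' w : star_type c v w -> star_type c v' w -> v = v'.
Proof.
have br x : star_type c x w -> exists2 C, x = branch C & star_type cD C w.
  move=> [sx ex]; have : x \in codom branch.
    by apply: contraPT sx => nb; rewrite card_star (negbTE nb).
  case/codomP=> C eC; exists C => //; have [w' ow' st] := simple_star_type K4D D_inj C.
  have [_] := branch_star_type st; rewrite -eC ex => eL.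
  by case: st => s e; split; rewrite // e.
move=> /br[C -> st] /br[C' -> st']; congr branch.
exact: simple_type_uniq K4D D_inj st st'.
Qed.

Lemma star_type_parity v w u : odd_label w -> star_type c v w -> parity u [set v] = (u \in line w).
Proof.
move=> ow [s3 ew]; rewrite -ew parity_injective //; apply/imset_injP.
by rewrite ew s3 card_line.
Qed.

(** Two vertices of $K_4$ are joined by exactly one edge, and its label lies on no other star. *)
Lemma common_label w w' : odd_label w -> odd_label w' -> w != w' ->
  exists t, forall w'', odd_label w'' -> (t \in line w'') = (w'' == w) || (w'' == w').
Proof.
move=> ow ow' ww'.
have : has (fun t => all (fun w'' => odd_label w'' ==>
   (((t != (false, false, false)) && ~~ ldot w'' t) == (w'' == w) || (w'' == w'))) labels) labels.
  by move: ow ow' ww'; case: w => [[[] []] []]; case: w' => [[[] []] []].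
case/hasP=> t _ /allP h; exists t => w'' ow''; rewrite inE.
by have := h w'' (mem_labels _); rewrite ow'' => /eqP.
Qed.

(* Meant for the cut formed by two edges of the same chain. *)
Lemma chain_cut_branch (X : {set vertex G}) v v' w w' :
  (forall u, \sum_(e in cut X) (c e == u : bool) = false) -> odd_label w -> odd_label w' ->
  star_type c v w -> star_type c v' w' -> (v \in X) = (v' \in X).
Proof.
move=> pX ow ow' st st'; case: (eqVneq w w') => [eww|ww'].
  by rewrite -eww in st'; rewrite (star_type_uniq st st').
have [t ht] := common_label ow ow' ww'.
have vv' : v != v' by apply: contraNneq ww' => ev; apply/eqP/line_inj => //;
  case: st => _ <-; case: st' => _ <-; rewrite ev.
(* Among all vertices only [v] and [v'] have odd parity at [t], so the parity of the cut compares
   the sides of these two. *)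
have : parity t X = \sum_(x in X) ((v == x : bool) + (v' == x : bool)).
  rewrite parity_sum; apply: eq_bigr => x _.
  case: (K4_star x) => [x2|[w'' ow'' stx]].
    rewrite parity_even //; case: eqP => [e|_]; first by case: st; rewrite e x2.
    by case: eqP => [e|//]; case: st'; rewrite e x2.
  rewrite (star_type_parity t ow'' stx) ht // ![_ == x]eq_sym.
  have -> : (x == v) = (w'' == w).
    apply/eqP/eqP => [ex|ew]; last by rewrite ew in stx; exact: star_type_uniq stx st.
    by apply: line_inj => //; case: st => _ <-; case: stx => _ <-; rewrite ex.
  have -> : (x == v') = (w'' == w').
    apply/eqP/eqP => [ex|ew]; last by rewrite ew in stx; exact: star_type_uniq stx st'.
    by apply: line_inj => //; case: st' => _ <-; case: stx => _ <-; rewrite ex.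
  case: (eqVneq w'' w) => [->|_] /=; last by case: (w'' == w').
  by rewrite (negbTE ww').
rewrite [parity t X]pX big_split /= !sum_eq_in.
by case: (v \in X); case: (v' \in X).
Qed.
End Structure.

Lemma cut_split (G : mgraph) (X : {set vertex G}) (x y : vertex G) e :
  x != y -> X = [set x; y] -> (e \in cut X) = (e \in cut [set x]) (+) (e \in cut [set y]).
Proof.
move=> xy ->; rewrite !inE; have no z : (z == x) && (z == y) = false.
  by apply/negbTE/negP=> /andP[/eqP-> /eqP e']; rewrite e' eqxx in xy.
move: (no (src e)) (no (tgt e)).
by case: (src e == x); case: (src e == y); case: (tgt e == x); case: (tgt e == y).
Qed.

Lemma star_injective (G : mgraph) (c : edge G -> label) v w :
  odd_label w -> star_type c v w -> {in cut [set v] &, injective c}.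
Proof. by move=> ow [s3 ew]; apply/imset_injP; rewrite ew s3 card_line. Qed.

(** * Contracting the edge of a chain next to a branch vertex *)

Section ContractEndEdge.
Variables (G : mgraph) (c : edge G -> label) (w : label).
Variables (b v : vertex G) (e e2 : edge G).
Hypotheses (K4c : K4_labelled c) (ow : odd_label w) (bw : star_type c b w).
Hypotheses (bv : b != v) (ends : forall x, (e \in cut [set x]) = (x == b) || (x == v)).
Hypotheses (ne : e2 != e) (star_v : cut [set v] = [set e; e2]) (ce : c e2 = c e).

Local Notation D := (contract [set e]).
Local Notation p := (contract_proj [set e]).
Local Notation cD := (c \o val : edge D -> label).

Lemma end_proj_eq x y : p x = p y -> x != y -> (x \in [:: b; v]) && (y \in [:: b; v]).
Proof.
have one x' y' : p x' = p y' -> x' != y' -> x' \in [:: b; v].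
  move=> pxy nxy; rewrite !inE -ends; apply: contraNT nxy => no.
  rewrite eq_sym -in_set1; apply: contract_proj_sat pxy _; last exact: set11.
  by move=> e'; rewrite inE => /eqP->.
by move=> pxy nxy; rewrite (one x y) // (one y x) // eq_sym.
Qed.

Lemma end_proj : p b = p v.
Proof.
have := contract_proj_joins (set11 e).
have := ends b; have := ends v; rewrite !eqxx orbT !inE.
case: (eqVneq (src e) b) => [->|sb] /=; first by rewrite (negbTE bv) /= => /eqP-> _.
move=> + /eqP tb; rewrite tb (negbTE bv) addbF => /eqP->.
by move/esym.
Qed.

Lemma end_card : #|edge D| = #|edge G|.-1.
Proof.
by rewrite card_sub -(cardC1 e); apply: eq_card => f; rewrite !inE.
Qed.

Lemma end_mult u : mult cD u = (mult c u - (u == c e))%N.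
Proof.
rewrite /mult -(card_imset _ val_inj) (cardsD1 e [set f | c f == u]) inE eq_sym addKn.
apply: eq_card => f; rewrite !inE; apply/imsetP/andP => [[g gu ->]|[fe fu]].
  by split; [have := valP g; rewrite inE | move: gu; rewrite inE].
have fZ : f \notin [set e] by rewrite inE.
by exists (Sub f fZ); rewrite ?inE ?SubK.
Qed.

Lemma end_K4 : K4_labelled cD.
Proof.
case: K4c => [[n0 conG labc c0 c1] onto]; split.
  split=> [|||f|f].
  - by apply/card_gt0P; exists (p b).
  - exact: cut_connected_contract.
  - exact: labelling_contract.
  - exact: c0.
  - exact: c1.
move=> u u0 u1; have [f fu] := onto u u0 u1.
case: (eqVneq f e) => [fe|fe].
  have h : e2 \notin [set e] by rewrite inE.
  by exists (Sub e2 h); rewrite /= ce -fe.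
have h : f \notin [set e] by rewrite inE.
by exists (Sub f h).
Qed.

Lemma end_star x (h : edge D) : x \notin [:: b; v] ->
  (h \in cut ([set p x] : {set vertex D})) = (val h \in cut [set x]).
Proof.
move=> nx; rewrite -(mem_imset _ _ val_inj) cut_contract.
suff -> : p @^-1: [set p x] = [set x] by [].
apply/setP=> y; rewrite !inE; apply/eqP/eqP => [pyx|-> //].
by apply/eqP/negP=> /negP/(end_proj_eq pyx)/andP[_]; apply/negP.
Qed.

Lemma end_star_v (h : edge D) : (val h \in cut [set v]) = (val h == e2).
Proof. by rewrite star_v !inE; have := valP h; rewrite inE => /negbTE->. Qed.

(** The merged vertex has as its star the symmetric difference of the two stars: [e] drops out and
    [e2] enters. *)
Lemma end_star_b (h : edge D) :
  (h \in cut ([set p b] : {set vertex D})) = (val h \in cut [set b]) (+) (val h == e2).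
Proof.
rewrite -(mem_imset _ _ val_inj) cut_contract -end_star_v; apply: cut_split => //.
apply/setP=> y; rewrite !inE; apply/eqP/orP => [pyb|[] /eqP-> //]; last by rewrite end_proj.
case: (eqVneq y b) => [|yb]; first by left.
by have /andP[] := end_proj_eq pyb yb; rewrite !inE (negbTE yb) /= => ->; right.
Qed.

Lemma end_other : e2 \notin cut [set b].
Proof.
apply/negP=> e2b; have eb : e \in cut [set b] by rewrite ends eqxx.
by have := star_injective ow bw e2b eb ce; apply/eqP.
Qed.

Lemma end_star_type : star_type cD (p b) w.
Proof.
have e2D : e2 \notin [set e] by rewrite inE.
have eb : e \in cut [set b] by rewrite ends eqxx.
have im : val @: cut ([set p b] : {set vertex D}) = e2 |: (cut [set b] :\ e).
  apply/setP=> f; apply/imsetP/idP => [[h hb ->]|].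
    move: hb; rewrite end_star_b in_setU1 in_setD1.
    have := valP h; rewrite inE => ->.
    by case: (eqVneq (val h) e2) => //= _; rewrite addbF.
  rewrite in_setU1 in_setD1 => fS; have fe : f \notin [set e].
    by rewrite inE; case/orP: fS => [/eqP->|/andP[]].
  exists (Sub f fe) => //; rewrite end_star_b SubK.
  by case/orP: fS => [/eqP->|/andP[_ fb]]; rewrite ?eqxx ?(negbTE end_other) //
    fb; case: eqVneq fb end_other => // -> ->.
have [s3 ew] := bw; split.
  rewrite -(card_imset _ val_inj) im cardsU1 in_setD1 negb_and end_other orbT.
  by have := cardsD1 e (cut [set b]); rewrite eb s3; lia.
rewrite imset_comp im -ew -(setD1K eb) !imsetU !imset_set1 ce.
by rewrite setU1K // !inE eqxx.
Qed.

End ContractEndEdge.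

(** The point is that the far end [v] of the [u]-edge at [b] is not a branch vertex when [u] occurs
    twice; its other edge then has label [u] too. *)
Lemma exists_end_edge (G : mgraph) (c : edge G -> label) u w :
  K4_labelled c -> (1 < mult c u)%N -> odd_label w -> u \in line w ->
  exists b v e e2, [/\ star_type c b w, b != v,
    forall x, (e \in cut [set x]) = (x == b) || (x == v),
    e2 != e & cut [set v] = [set e; e2] /\ (c e2 = c e /\ c e = u)].
Proof.
move=> K4c mu ow uw; have [b bw] := star_type_onto K4c ow.
have [e eb ceu] : exists2 e, e \in cut [set b] & c e = u.
  by have [_ ew] := bw; move: uw; rewrite -ew => /imsetP[e eb ->]; exists e.
have loop := K4_loopless K4c e.
pose v := if src e == b then tgt e else src e.
have ends x : (e \in cut [set x]) = (x == b) || (x == v).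
  move: eb loop; rewrite /v !inE ![x == _]eq_sym.
  case: (eqVneq (src e) b) => [->|sb] /=.
    case: (eqVneq b x) => [<-|_] /=; first by rewrite [tgt e == b]eq_sym => _ /negbTE->.
    by [].
  move=> /eqP tb _; rewrite tb.
  by case: (eqVneq b x) => [<-|_]; rewrite ?(negbTE sb) ?addbF.
have bv : b != v.
  by rewrite /v; case: (eqVneq (src e) b) => [<- //|]; rewrite eq_sym.
case: (K4c) => [[n0 conG labc c0 c1] onto].
have [e2 ne ce2] : exists2 e2, e2 != e & c e2 = u.
  have := cardsD1 e [set f | c f == u]; rewrite -/(mult c u) inE ceu eqxx => h.
  have : (0 < #|[set f | c f == u] :\ e|)%N by lia.
  by case/card_gt0P=> f; rewrite !inE => /andP[fe /eqP fu]; exists f.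
have e_e2 : e \notin [set e2] by rewrite inE eq_sym.
have v2 : #|cut [set v]| = 2%N.
  case: (K4_star K4c v) => // -[w' ow' vw'].
  (* Two edges with equal labels form a cut. If [v] were a branch vertex, [chain_cut_branch] would
     put [b] and [v] on the same side, although [e] crosses the cut. *)
  have /(labc [set e; e2]) [X eX] : \sum_(f in [set e; e2]) c f = 0.
    by rewrite big_setU1 //= big_set1 ceu ce2 label_addxx.
  have : (b \in X) = (v \in X).
    apply: (chain_cut_branch K4c _ ow ow' bw vw') => t.
    rewrite -eX big_setU1 //= big_set1 ceu ce2. by case: (u == t).
  have : e \in cut X by rewrite -eX !inE eqxx.
  have := ends b; have := ends v; rewrite !eqxx orbT !inE.
  rewrite /v; case: (eqVneq (src e) b) => [->|sb] /=.
    by move=> _ _; case: (_ \in X); case: (_ \in X).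
  move=> _ /eqP->.
  by case: (_ \in X); case: (_ \in X).
have [f [g [fg sv cfg]]] := card_star2 labc v2.
have ev : e \in cut [set v] by rewrite ends eqxx orbT.
move: (ev); rewrite sv !inE => /orP[] /eqP ee.
  exists b, v, e, g; split=> //; first by rewrite ee eq_sym.
  by rewrite sv ee; split=> //; split; rewrite // -ceu ee.
exists b, v, e, f; split=> //; first by rewrite ee.
by rewrite sv ee setUC; split=> //; split; rewrite // -ceu ee.
Qed.

(** Labels are carried along because the induction recognises the images of [b] and [e2] by them. *)
Definition label_star_iso (G H : mgraph) (c : edge G -> label) (d : edge H -> label)
    (f : vertex G -> vertex H) (g : edge G -> edge H) : Prop :=
  [/\ bijective f, bijective g, forall e, d (g e) = c e
    & forall v e, (e \in cut [set v]) = (g e \in cut [set f v])].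

Lemma mult_le1_inj (G : mgraph) (c : edge G -> label) :
  (forall u, mult c u <= 1)%N -> injective c.
Proof.
move=> h e f ef; apply: (card_le1_eqP (h (c e))); by rewrite !inE ?ef.
Qed.

Lemma simple_iso (G H : mgraph) (c : edge G -> label) (d : edge H -> label) :
  K4_labelled c -> K4_labelled d -> injective c -> injective d ->
  exists f g, label_star_iso c d f g.
Proof.
move=> K4c K4d c_inj d_inj.
have [cG vG] := simple_card K4c c_inj; have [cH vH] := simple_card K4d d_inj.
have exg e : exists e', d e' == c e.
  case: K4c => [[_ _ _ c0 c1] _]; case: K4d => [_ onto].
  by have [e' <-] := onto _ (c0 e) (c1 e); exists e'.
have exf v : exists v', d @: cut [set v'] == c @: cut [set v].
  have [w ow [_ ->]] := simple_star_type K4c c_inj v.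
  by have [v' [_ <-]] := simple_type_onto K4d d_inj ow; exists v'.
pose g e := xchoose (exg e); pose f v := xchoose (exf v).
have gP e : d (g e) = c e by apply/eqP/(xchooseP (exg e)).
have fP v : d @: cut [set f v] = c @: cut [set v] by apply/eqP/(xchooseP (exf v)).
have f_inj : injective f.
  move=> x y fxy; have [w ow st] := simple_star_type K4c c_inj x.
  apply: (simple_type_uniq K4c c_inj st); case: st => s3 e; split.
    exact: (simple_card_star K4c c_inj y).
  by rewrite -fP -fxy fP.
have g_inj : injective g by move=> x y gxy; apply: c_inj; rewrite -!gP gxy.
exists f, g; split=> //; try by apply: inj_card_bij; rewrite ?vG ?vH ?cG ?cH.
by move=> v e; rewrite -(mem_imset _ _ c_inj) -(mem_imset _ _ d_inj) fP gP.
Qed.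

Lemma line_cover u : u != 0 -> u != (true, true, true) -> exists2 w, odd_label w & u \in line w.
Proof.
move=> u0 u1.
have : has (fun w => odd_label w && ((u != (false, false, false)) && ~~ ldot w u)) labels.
  by case: u u0 u1 => [[[] []] []].
by case/hasP=> w _ /andP[ow uw]; exists w; rewrite // inE.
Qed.

Lemma K4_label_iso n (G H : mgraph) (c : edge G -> label) (d : edge H -> label) :
  (#|edge G| <= n)%N -> K4_labelled c -> K4_labelled d -> (forall u, mult c u = mult d u) ->
  exists f g, label_star_iso c d f g.
Proof.
elim: n G H c d => [|n IHn] G H c d.
  by move=> G0 K4c; have := K4_card K4c; lia.
move=> Gn K4c K4d cd.
have cardEq : #|edge G| = #|edge H|.
  by rewrite (card_edge_mult c) (card_edge_mult d); apply: eq_bigr.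
have cardV : #|vertex G| = #|vertex H|.
  by have := K4_card K4c; have := K4_card K4d; lia.
case: (boolP [exists u, 1 < mult c u]%N) => [/existsP[u mu]|]; last first.
  rewrite negb_exists => /forallP h.
  have c_inj : injective c by apply: mult_le1_inj => u; rewrite leqNgt h.
  have d_inj : injective d by apply: mult_le1_inj => u; rewrite -cd leqNgt h.
  exact: simple_iso.
have [u0 u1] : u != 0 /\ u != (true, true, true).
  case/ltnW/card_gt0P: mu => e; rewrite inE => /eqP <-.
  by case: K4c => [[_ _ _ c0 c1] _]; rewrite c0 c1.
have [w ow uw] := line_cover u0 u1.
have [b [v [e [e2 [bw bv ends ne [sv [ce cu]]]]]]] := exists_end_edge K4c mu ow uw.
rewrite cd in mu.
have [b' [v' [e' [e2' [bw' bv' ends' ne' [sv' [ce' cu']]]]]]] := exists_end_edge K4d mu ow uw.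
pose cD : edge (contract [set e]) -> label := c \o val.
pose dD : edge (contract [set e']) -> label := d \o val.
have K4cD : K4_labelled cD := end_K4 b K4c ne ce.
have K4dD : K4_labelled dD := end_K4 b' K4d ne' ce'.
have cdD t : mult cD t = mult dD t by rewrite !end_mult cd cu cu'.
have Dn : (#|edge (contract [set e])| <= n)%N by rewrite end_card; lia.
have [f1 [g1 [f1_bij g1_bij dg1 st1]]] := IHn _ _ _ _ Dn K4cD K4dD cdD.
pose p := contract_proj [set e] : vertex G -> vertex (contract [set e]).
pose p' := contract_proj [set e'] : vertex H -> vertex (contract [set e']).
have pbv : p b = p v := end_proj bv ends.
have pbv' : p' b' = p' v' := end_proj bv' ends'.
have tb : star_type cD (p b) w := end_star_type ow bw bv ends ne sv ce.
have tb' : star_type dD (p' b') w := end_star_type ow bw' bv' ends' ne' sv' ce'.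
have g1star C : g1 @: cut [set C] = cut [set f1 C].
  apply/setP=> h; have [g1' g1K g1K'] := g1_bij; rewrite -{1}(g1K' h).
  by rewrite (mem_imset _ _ (bij_inj g1_bij)) st1 g1K'.
(* Both vertices have type [w], and a type determines its vertex. *)
have f1b : f1 (p b) = p' b'.
  apply: (star_type_uniq K4dD _ tb'); have [s3 eL] := tb; split.
    by rewrite -g1star (card_imset _ (bij_inj g1_bij)).
  by rewrite -eL -g1star -imset_comp; apply: eq_imset => h; rewrite /= dg1.
have e2D : e2 \notin [set e] by rewrite inE.
have e2D' : e2' \notin [set e'] by rewrite inE.
pose h2 : edge (contract [set e]) := Sub e2 e2D.
pose h2' : edge (contract [set e']) := Sub e2' e2D'.
have h2b : h2 \in cut [set p b].
  by rewrite (end_star_b bv ends sv) eqxx (negbTE (end_other ow bw ends ne ce)).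
have h2b' : h2' \in cut [set p' b'].
  by rewrite (end_star_b bv' ends' sv') eqxx (negbTE (end_other ow bw' ends' ne' ce')).
have g1h2 : g1 h2 = h2'.
  apply: (star_injective ow tb') => //; first by rewrite -f1b -st1.
  by rewrite dg1 /cD /dD /= ce ce' cu cu'.
(* Only the merged vertex has two preimages, [b'] and [v']; excluding [v'] makes the lift unique and
   reserves [v'] for [v]. *)
have exf C : exists y, (p' y == C) && (y != v').
  have [y <-] := contract_proj_surj C; case: (eqVneq y v') => [->|yv]; last first.
    by exists y; rewrite eqxx.
  by exists b'; rewrite pbv' eqxx.
pose f x := if x == v then v' else xchoose (exf (f1 (p x))).
have fv : f v = v' by rewrite /f eqxx.
have fP x : x != v -> p' (f x) = f1 (p x) /\ f x != v'.
  by rewrite /f => /negbTE->; have /andP[/eqP] := xchooseP (exf (f1 (p x))).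
clearbody f; have p_inj x y : p x = p y -> x != v -> y != v -> x = y.
  move=> pxy xv yv; apply/eqP/negP=> /negP nxy.
  have := end_proj_eq ends pxy nxy; rewrite !inE (negbTE xv) (negbTE yv) !orbF.
  by case/andP=> /eqP xb /eqP yb; rewrite xb yb eqxx in nxy.
have p_inj' x y : p' x = p' y -> x != v' -> y != v' -> x = y.
  move=> pxy xv yv; apply/eqP/negP=> /negP nxy.
  have := end_proj_eq ends' pxy nxy; rewrite !inE (negbTE xv) (negbTE yv) !orbF.
  by case/andP=> /eqP xb /eqP yb; rewrite xb yb eqxx in nxy.
have fb : f b = b'.
  by have [pfb fbv] := fP b bv; apply: p_inj' => //; rewrite pfb.
have f_inj : injective f.
  move=> x y; case: (eqVneq x v) => [->|xv]; case: (eqVneq y v) => [->|yv] //.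
  - by rewrite fv => /esym fy; have [_] := fP y yv; rewrite fy eqxx.
  - by rewrite fv => fx; have [_] := fP x xv; rewrite fx eqxx.
  move=> fxy; apply: p_inj => //; apply: (bij_inj f1_bij).
  by rewrite -(fP x xv).1 -(fP y yv).1 fxy.
pose g h := if insub h is Some h1 then val (g1 h1) else e'.
have ge : g e = e' by rewrite /g insubN // inE eqxx.
have gE (h1 : edge (contract [set e])) : g (val h1) = val (g1 h1) by rewrite /g valK.
clearbody g; have edgeP h : h = e \/ exists h1 : edge (contract [set e]), h = val h1.
  case: (eqVneq h e) => [->|he]; [by left | right].
  have hD : h \notin [set e] by rewrite inE.
  by exists (Sub h hD).
have g_neq h1 : val (g1 h1) != e' by have := valP (g1 h1); rewrite inE.
have g_inj : injective g.
  move=> x y; case: (edgeP x) => [->|[x1 ->]]; case: (edgeP y) => [->|[y1 ->]] //.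
  - by rewrite ge gE => h; have := g_neq y1; rewrite -h eqxx.
  - by rewrite ge gE => h; have := g_neq x1; rewrite h eqxx.
  by rewrite !gE => /val_inj/(bij_inj g1_bij) ->.
exists f, g; split; try by apply: inj_card_bij; rewrite ?cardV ?cardEq.
  by move=> h; case: (edgeP h) => [->|[h1 ->]]; rewrite ?ge ?gE ?cu ?cu' //; exact: dg1.
move=> x h; case: (edgeP h) => [->|[h1 ->]].
  by rewrite ge ends ends' -fb -fv !(inj_eq f_inj).
rewrite gE; case: (eqVneq x v) => [->|xv].
  rewrite fv (end_star_v sv) (end_star_v sv').
  have -> : e2 = val h2 by []; have -> : e2' = val (g1 h2) by rewrite g1h2.
  by rewrite !(inj_eq val_inj) (inj_eq (bij_inj g1_bij)).
case: (eqVneq x b) => [->|xb].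
  have := end_star_b bv ends sv h1; have := end_star_b bv' ends' sv' (g1 h1).
  rewrite fb -[contract_proj [set e'] b']f1b -st1 => -> /esym.
  have -> : e2 = val h2 by []; have -> : e2' = val (g1 h2) by rewrite g1h2.
  by rewrite !(inj_eq val_inj) (inj_eq (bij_inj g1_bij)) => /addIb.
have [pfx fxv] := fP x xv.
have nx : x \notin [:: b; v] by rewrite !inE negb_or xb.
have nx' : f x \notin [:: b'; v'] by rewrite !inE negb_or fxv -fb (inj_eq f_inj) xb.
have := end_star ends (x := x) h1 nx; have := end_star ends' (x := f x) (g1 h1) nx'.
by rewrite -/(p x) -/(p' (f x)) pfx -st1 => -> <-.
Qed.

Lemma card_bij (S T : finType) : #|S| = #|T| -> exists f : S -> T, bijective f.
Proof.
move=> eST; exists (fun x => enum_val (cast_ord eST (enum_rank x))).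
exists (fun y => enum_val (cast_ord (esym eST) (enum_rank y))) => x.
  by rewrite enum_valK cast_ordK enum_rankK.
by rewrite enum_valK cast_ordKV enum_rankK.
Qed.

Lemma sum_edge_labels (G : mgraph) (c : edge G -> label) :
  \sum_e c e = \sum_(u : label) (u : label) *+ mult c u.
Proof.
rewrite (partition_big c xpredT) //=; apply: eq_bigr => u _.
rewrite (eq_bigr (fun=> u : label)) => [|e /eqP //].
by rewrite sumr_const; congr (_ *+ _); apply: eq_card => e; rewrite inE.
Qed.

(** * Reconstruction with at most three vertices *)

Lemma small_cut (G : mgraph) (X : {set vertex G}) :
  (#|vertex G| <= 3)%N -> cut X != set0 -> exists v, cut X = cut [set v].
Proof.
move=> n3 nX; have cX := cardsC X.
case: (leqP #|X| 1) => hX.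
  case: (posnP #|X|) => [/eqP|X0].
    by rewrite cards_eq0 => /eqP eX; rewrite eX cut0 eqxx in nX.
  have /cards1P[v ->] : #|X| == 1%N by rewrite eqn_leq hX X0.
  by exists v.
have {}hX : (#|~: X| <= 1)%N by lia.
case: (posnP #|~: X|) => [/eqP|X0].
  by rewrite cards_eq0 => /eqP eX; rewrite -cutC eX cut0 eqxx in nX.
have /cards1P[v eX] : #|~: X| == 1%N by rewrite eqn_leq hX X0.
by exists v; rewrite -eX cutC.
Qed.

Lemma one_vertex_isomorphic (G H : mgraph) :
  #|vertex G| = 1%N -> #|vertex H| = 1%N -> #|edge G| = #|edge H| -> isomorphic G H.
Proof.
move=> nG nH cardE; have [f f_bij] : exists f : vertex G -> vertex H, bijective f.
  by apply: card_bij; rewrite nG nH.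
have [g g_bij] := card_bij cardE; exists f, g; split=> // e.
have one x y : x = y :> vertex H by apply: (card_le1_eqP (A := vertex H)); rewrite ?nH.
by rewrite /joins (one (src (g e)) (f (src e))) (one (tgt (g e)) (f (tgt e))) !eqxx.
Qed.

Section SmallIsomorphism.
Variables (G H : mgraph) (c : edge G -> label) (d : edge H -> label).
Hypothesis conG : cut_connected G.
Hypotheses (labc : labelling c) (labd : labelling d).
Hypotheses (c_inj : injective c) (d_inj : injective d).
Hypotheses (cardE : #|edge G| = #|edge H|) (cardV : #|vertex G| = #|vertex H|).
Hypothesis cd : forall u, mult c u = mult d u.
Hypotheses (n2 : (1 < #|vertex G|)%N) (n3 : (#|vertex G| <= 3)%N).
Hypothesis loopless : forall e : edge G, src e != tgt e.

(** The bijection of edges given by the labels maps stars to nonempty cuts, which are again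
    stars. *)
Lemma small_isomorphic : isomorphic G H.
Proof.
have exg e : exists e', d e' == c e.
  have : (0 < mult d (c e))%N by rewrite -cd; apply/card_gt0P; exists e; rewrite inE.
  by case/card_gt0P=> e'; rewrite inE; exists e'.
pose g e := xchoose (exg e).
have gP e : d (g e) = c e by apply/eqP/(xchooseP (exg e)).
have g_inj : injective g by move=> x y gxy; apply: c_inj; rewrite -!gP gxy.
have g_bij : bijective g by apply: inj_card_bij; rewrite ?cardE.
have star_image v : exists v', g @: cut [set v] == cut [set v'].
  have [Y eY] : exists Y, g @: cut [set v] = cut Y.
    apply/(labd (g @: cut [set v])); rewrite big_imset /=; last by move=> x y _ _; exact: g_inj.
    rewrite (eq_bigr c) => [|e _]; last exact: gP.
    by apply/(labc (cut [set v])); exists [set v].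
  have Y0 : cut Y != set0.
    rewrite -eY -card_gt0 card_imset // card_gt0.
    exact: cut_star_neq0.
  have [v' ev'] := small_cut (leq_trans (eq_leq (esym cardV)) n3) Y0.
  by exists v'; rewrite eY ev'.
have [f f_bij fP] : exists2 f : vertex G -> vertex H, bijective f &
    forall v, g @: cut [set v] = cut [set f v].
  (* With two vertices both stars are the same cut, so any bijection of vertices works; with three,
     a star determines its vertex. *)
  case: (eqVneq #|vertex G| 2%N) => [n2'|n2'].
    have [f f_bij] := card_bij cardV; exists f => // v.
    have [v' /eqP ->] := star_image v.
    case: (eqVneq v' (f v)) => [-> //|ne]; rewrite -cutC; congr cut.
    apply/eqP; rewrite eqEcard cards1; apply/andP; split; last first.
      by have := cardsC [set v']; rewrite cards1; lia.
    have := cardsC [set v']; rewrite cards1 -cardV n2' => -[] /eqP/cards1P[y ey].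
    have : f v \in ~: [set v'] by rewrite !inE eq_sym.
    by rewrite ey inE => /eqP->.
  pose f v := xchoose (star_image v).
  have fP v : g @: cut [set v] = cut [set f v] by apply/eqP/(xchooseP (star_image v)).
  exists f => //; apply: inj_card_bij; last by rewrite cardV.
  move=> x y fxy; have /(imset_inj g_inj) : g @: cut [set x] = g @: cut [set y] by rewrite !fP fxy.
  case/(cut_inj conG) => [/set1_inj //|eC].
  by have := cardsC [set x]; rewrite -eC !cards1; move: n2'; lia.
apply: (isomorphic_of_stars f_bij g_bij _ loopless) => v e.
by rewrite -fP (mem_imset _ _ g_inj).
Qed.
End SmallIsomorphism.

Lemma optimal_isomorphic q (G H : mgraph) (c : edge G -> label) (d : edge H -> label) :
  (0 < #|vertex G|)%N -> (0 < #|vertex H|)%N -> cut_connected G -> cut_connected H ->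
  #|vertex G| = #|vertex H| -> #|edge G| = (#|vertex G| + 2)%N -> #|edge H| = (#|vertex H| + 2)%N ->
  labelling c -> labelling d -> (forall e, c e != 0) -> (forall e, d e != 0) ->
  mult c (true, true, true) = 0%N -> mult d (true, true, true) = 0%N ->
  optimal_profile q (mult c) -> optimal_profile q (mult d) -> isomorphic G H.
Proof.
move=> nG nH conG conH cardV mG mH labc labd c0 d0 c1 d1 opc opd.
have cardE : #|edge G| = #|edge H| by rewrite mG mH cardV.
have {c labc c0 c1 opc} [c [k [labc c0 k6 [eG c1 mc]]]] := optimal_labelling labc c0 c1 opc.
have {d labd d0 d1 opd} [d [k' [labd d0 _ [eH d1 md]]]] := optimal_labelling labd d0 d1 opd.
have ek : k' = k by lia.
rewrite {k'}ek in eH md.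
have cd u : mult c u = mult d u.
  case: (eqVneq u 0) => [->|u0].
    by rewrite /mult !eq_card0 // => e; rewrite !inE; apply/negbTE; rewrite ?c0 ?d0.
  by case: (eqVneq u (true, true, true)) => [->|u1]; rewrite ?c1 ?d1 // mc ?md.
have not1 (K : mgraph) (b : edge K -> label) : mult b (true, true, true) = 0%N ->
    forall e, b e != (true, true, true).
  move=> b1 e; apply/negP=> be; have : (0 < mult b (true, true, true))%N.
    by apply/card_gt0P; exists e; rewrite inE.
  by rewrite b1.
case: (posnP q) => [q0|qpos]; last first.
  have onto (K : mgraph) (b : edge K -> label) : matches q (standard_pattern k) (mult b) ->
      forall u, u != 0 -> u != (true, true, true) -> exists e, b e = u.
    move=> mb u u0 u1; have : (0 < mult b u)%N by rewrite mb //; lia.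
    by case/card_gt0P=> e; rewrite inE => /eqP; exists e.
  have K4c : K4_labelled c.
    by split; [split => //; exact: not1 | exact: onto].
  have K4d : K4_labelled d.
    by split; [split => //; exact: not1 | exact: onto].
  have [f [g [f_bij g_bij _ st]]] := K4_label_iso (leqnn _) K4c K4d cd.
  exact: isomorphic_of_stars f_bij g_bij st (K4_loopless K4c).
rewrite {q}q0 muln0 !add0n in mc md eG eH *.
have le1 (K : mgraph) (b : edge K -> label) : matches 0 (standard_pattern k) (mult b) ->
   (forall e, b e != 0) -> mult b (true, true, true) = 0%N -> injective b.
  move=> mb b0 b1; apply: mult_le1_inj => u; case: (eqVneq u 0) => [->|u0].
    by rewrite /mult eq_card0 // => e; rewrite !inE; apply/negbTE.
  case: (eqVneq u (true, true, true)) => [->|u1]; first by rewrite b1.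
  by rewrite mb // add0n leq_b1.
have c_inj := le1 _ _ mc c0 c1; have d_inj := le1 _ _ md d0 d1.
case: (ltnP 1 #|vertex G|) => n2; last first.
  by apply: one_vertex_isomorphic => //; lia.
apply: (small_isomorphic conG labc labd) => //; first by lia.
(* Loops must be excluded. With three vertices and five edges, the stars have total size at least 9,
   so at least five edges are not loops. *)
case: (eqVneq #|vertex G| 2%N) => [v2|v2]; last first.
  move=> e; have : (9 <= \sum_(v : vertex G) #|cut [set v]|)%N.
    apply: (@leq_trans (\sum_(v : vertex G) 3)).
      by rewrite sum_nat_const -[#|xpredT|]/#|vertex G|; lia.
    by apply: leq_sum => v _; exact: card_star_gt2 conG labc c0 v c_inj n2.
  rewrite sum_card_star => h.
  have sub := subset_leq_card (subsetT [set e : edge G | src e != tgt e]).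
  rewrite cardsT in sub.
  have nT : [set e : edge G | src e != tgt e] = setT.
    by apply/eqP; rewrite eqEcard subsetT cardsT; lia.
  by have := in_setT e; rewrite -nT inE.
(* With two vertices the four labels form two opposite pairs and add up to 0, so the whole edge set
   is a cut and contains no loop. *)
have k4 : k = 4%N by lia.
rewrite k4 in mc.
have [X eX] : exists X, [set: edge G] = cut X.
  apply/(labc setT); rewrite (eq_bigl xpredT) => [|e]; last by rewrite inE.
  have c00 : mult c (false, false, false) = 0%N.
    by rewrite /mult eq_card0 // => e; rewrite !inE; apply/negbTE.
  by rewrite sum_edge_labels big_label c1 c00 !mc.
by move=> e; have := in_setT e; rewrite eX inE; apply: contraTneq => ->; rewrite addbb.
Qed.

(** * Comparison of reliabilities *)

Lemma relabel_missing g : g != 0 :> label ->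
  exists phi : label -> label,
    [/\ {morph phi : u v / u + v}, injective phi & phi g = (true, true, true)].
Proof.
move=> g0.
have : has (fun p => has (fun q => has (fun r => (linear_label p q r g == (true, true, true)) &&
    all (fun u => (linear_label p q r u == (false, false, false)) ==>
      (u == (false, false, false))) labels) labels) labels) labels.
  by case: g g0 => [[[] []] []].
case/hasP=> p _ /hasP[q _ /hasP[r _ /andP[/eqP fg /allP ker]]].
exists (linear_label p q r); split=> // [|u v euv]; first exact: linear_labelD.
apply/eqP; rewrite -label_add_eq0; apply: (implyP (ker _ (mem_labels _))).
by rewrite linear_labelD euv label_addxx.
Qed.

Lemma exists_K4_labelling (G : mgraph) :
  (0 < #|vertex G|)%N -> cut_connected G -> #|edge G| = (#|vertex G| + 2)%N ->
  exists2 c : edge G -> label, labelling c & mult c (true, true, true) = 0%N.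
Proof.
move=> n0 conG mG; have [c labc] := exists_labelling n0 conG mG.
have [g g0 cg] := missing_label n0 conG labc.
have [phi [phiD phi_inj phig]] := relabel_missing g0.
exists (phi \o c); first exact: labelling_comp.
rewrite -phig mult_comp //; apply: eq_card0 => e; rewrite !inE; apply/negbTE; exact: cg.
Qed.

Lemma card_edge_profile (G : mgraph) (c : edge G -> label) :
  mult c (true, true, true) = 0%N ->
  #|edge G| = (profile1 (mult c) + mult c (false, false, false))%N.
Proof. by move=> c1; rewrite (card_edge_mult c) sum_label c1 /profile1; lia. Qed.

Lemma mult0P (G : mgraph) (c : edge G -> label) u :
  mult c u = 0%N <-> forall e, c e != u.
Proof.
split=> [cu e|cu]; last by apply: eq_card0 => e; rewrite !inE; apply/negbTE; exact: cu.
apply/negP=> ce; have : (0 < mult c u)%N by apply/card_gt0P; exists e; rewrite inE.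
by rewrite cu.
Qed.

Lemma reliability_profile (R : realType) (G : mgraph) (c : edge G -> label) (p : R) :
  cut_connected G -> labelling c -> mult c (true, true, true) = 0%N ->
  reliability G p = p ^+ #|edge G| + (profile1 (mult c))%:R * (p ^+ (#|edge G| - 1) * (1 - p))
    + (profile2 (mult c))%:R * (p ^+ (#|edge G| - 2) * (1 - p) ^+ 2)
    + (profile3 (mult c))%:R * (p ^+ (#|edge G| - 3) * (1 - p) ^+ 3).
Proof.
move=> conG labc c1; rewrite (reliability_independents p conG labc).
rewrite !big_ord_recr big_ord0 /= independents0 independents_profile1 //.
rewrite independents_profile2 // independents_profile3 //.
by rewrite add0r mul1r subn0 expr0 mulr1 expr1.
Qed.

(** All weights $p^{m-i}(1-p)^i$ are positive, so one strict inequality among the three counts is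
    enough; equality throughout yields an isomorphism. *)
Lemma optimal_uniquely_optimal (R : realType) (q : nat) (G H : mgraph)
    (c : edge G -> label) (p : R) :
  (0 < #|vertex G|)%N -> cut_connected G -> cut_connected H ->
  #|vertex G| = #|vertex H| -> #|edge G| = (#|vertex G| + 2)%N -> #|edge H| = #|edge G| ->
  labelling c -> (forall e, c e != 0) -> mult c (true, true, true) = 0%N ->
  optimal_profile q (mult c) -> ~ isomorphic H G -> 0 < p < 1 ->
  reliability H p < reliability G p.
Proof.
move=> nG conG conH cardV mG cardE labc c0 c1 opc niso /andP[p0 p1].
have nH : (0 < #|vertex H|)%N by rewrite -cardV.
have mH : #|edge H| = (#|vertex H| + 2)%N by rewrite cardE mG cardV.
have [d labd d1] := exists_K4_labelling nH conH mH.
have eG := card_edge_profile c1; have eH := card_edge_profile d1.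
have c00 : mult c (false, false, false) = 0%N by apply/mult0P.
rewrite c00 addn0 in eG.
have le1 : (profile1 (mult d) <= profile1 (mult c))%N by rewrite -eG -cardE eH leq_addr.
have [le2 le3 eq_opt] := optimal_profile_max opc le1.
rewrite (reliability_profile p conG labc c1) (reliability_profile p conH labd d1) cardE.
set w1 := _ * (1 - p); set w2 := _ * (1 - p) ^+ 2; set w3 := _ * (1 - p) ^+ 3.
have q0 : 0 < 1 - p by rewrite subr_gt0.
have w1_gt0 : 0 < w1 by rewrite mulr_gt0 // exprn_gt0.
have w2_gt0 : 0 < w2 by rewrite mulr_gt0 // exprn_gt0.
have w3_gt0 : 0 < w3 by rewrite mulr_gt0 // exprn_gt0.
have m1 : (profile1 (mult d))%:R * w1 <= (profile1 (mult c))%:R * w1.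
  by rewrite ler_pM2r // ler_nat.
have m2 : (profile2 (mult d))%:R * w2 <= (profile2 (mult c))%:R * w2.
  by rewrite ler_pM2r // ler_nat.
have m3 : (profile3 (mult d))%:R * w3 <= (profile3 (mult c))%:R * w3.
  by rewrite ler_pM2r // ler_nat.
move: le1; rewrite leq_eqVlt => /orP[/eqP e1|lt1]; last first.
  have : (profile1 (mult d))%:R * w1 < (profile1 (mult c))%:R * w1.
    by rewrite ltr_pM2r // ltr_nat.
  lra.
move: le2; rewrite leq_eqVlt => /orP[/eqP e2|lt2]; last first.
  have : (profile2 (mult d))%:R * w2 < (profile2 (mult c))%:R * w2.
    by rewrite ltr_pM2r // ltr_nat.
  lra.
move: le3; rewrite leq_eqVlt => /orP[/eqP e3|lt3]; last first.
  have : (profile3 (mult d))%:R * w3 < (profile3 (mult c))%:R * w3.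
    by rewrite ltr_pM2r // ltr_nat.
  lra.
exfalso; apply: niso; case: (eq_opt e1 e2 e3) => [le3|opd].
  have vG : #|vertex G| = 1%N by move: le3 mG nG; rewrite eG; clear; lia.
  by apply: one_vertex_isomorphic; rewrite -?cardV.
have d0 : forall e, d e != 0.
  apply/(mult0P d (false, false, false)); move: eH; rewrite cardE eG e1; clear.
  by lia.
exact: optimal_isomorphic nH nG conH conG (esym cardV) mH mG labd labc d0 c0 d1 c1 opd opc.
Qed.

(** * Weak subdivisions of K4 *)

(* The three edges at each vertex have label sum 0, and the label
   [(true, true, true)] is missing; opposite edges add up to it. *)
Definition K4_label (e : edge K4) : label :=
  match nat_of_ord (val e).1, nat_of_ord (val e).2 with
  | 0, 1 => (true, false, false)
  | 0, 2 => (false, true, false)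
  | 0, 3 => (true, true, false)
  | 1, 2 => (false, false, true)
  | 1, 3 => (true, false, true)
  | _, _ => (false, true, true)
  end.

Definition K4_edge (i j : nat) (hi : (i < 4)%N) (hj : (j < 4)%N) (hij : (i < j)%N) : edge K4 :=
  exist (fun e : 'I_4 * 'I_4 => (e.1 < e.2)%N) (Ordinal hi, Ordinal hj) hij.

Definition e01 : edge K4 := @K4_edge 0 1 isT isT isT.
Definition e02 : edge K4 := @K4_edge 0 2 isT isT isT.
Definition e03 : edge K4 := @K4_edge 0 3 isT isT isT.
Definition e12 : edge K4 := @K4_edge 1 2 isT isT isT.
Definition e13 : edge K4 := @K4_edge 1 3 isT isT isT.
Definition e23 : edge K4 := @K4_edge 2 3 isT isT isT.

Lemma K4_edgeP (e : edge K4) :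
  [\/ e = e01, e = e02 | e = e03] \/ [\/ e = e12, e = e13 | e = e23].
Proof.
case: e => [[[i hi] [j hj]] /= hij].
have E (i' j' : nat) hi' hj' hij' : i = i' -> j = j' ->
  exist (fun e : 'I_4 * 'I_4 => (e.1 < e.2)%N) (Ordinal hi, Ordinal hj) hij
    = @K4_edge i' j' hi' hj' hij'.
  by move=> ei ej; apply/val_inj; congr (_, _); apply/val_inj.
move: i hi j hj hij E => [|[|[|[|//]]]] hi [|[|[|[|//]]]] hj //= hij E.
- by left; constructor 1; exact: E.
- by left; constructor 2; exact: E.
- by left; constructor 3; exact: E.
- by right; constructor 1; exact: E.
- by right; constructor 2; exact: E.
- by right; constructor 3; exact: E.
Qed.

Lemma big_K4 (R : Type) (idx : R) (op : Monoid.com_law idx) (F : edge K4 -> R) :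
  \big[op/idx]_e F e =
    op (F e01) (op (F e02) (op (F e03) (op (F e12) (op (F e13) (F e23))))).
Proof.
rewrite -big_enum (perm_big [:: e01; e02; e03; e12; e13; e23]) /=.
  by rewrite !big_cons big_nil Monoid.mulm1.
apply: uniq_perm; rewrite ?enum_uniq // => e; rewrite mem_enum inE; apply/esym.
by case: (K4_edgeP e) => -[] ->.
Qed.

Lemma K4_label_inj : injective K4_label.
Proof.
by move=> e f; case: (K4_edgeP e) => -[] ->; case: (K4_edgeP f) => -[] ->.
Qed.

Lemma K4_label_neq0 e : K4_label e != 0.
Proof. by case: (K4_edgeP e) => -[] ->. Qed.

Lemma K4_label_neq1 e : K4_label e != (true, true, true).
Proof. by case: (K4_edgeP e) => -[] ->. Qed.

Definition edge_of_label (u : label) : edge K4 :=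
  match u with
  | (true, false, false) => e01
  | (false, true, false) => e02
  | (true, true, false) => e03
  | (false, false, true) => e12
  | (true, false, true) => e13
  | _ => e23
  end.

Lemma edge_of_labelK u : u != 0 -> u != (true, true, true) -> K4_label (edge_of_label u) = u.
Proof. by case: u => [[[] []] []]. Qed.

Lemma K4_flow (X : {set vertex K4}) : \sum_(e in cut X) K4_label e = 0.
Proof.
rewrite big_mkcond big_K4 !inE /=.
by do 4!case: (_ \in X).
Qed.

Lemma K4_connected : cut_connected K4.
Proof.
move=> X /setP h.
move: (h e01) (h e02) (h e03); rewrite !inE /=.
set x0 := Ordinal _; set x1 := Ordinal _; set x2 := Ordinal _; set x3 := Ordinal _.
have P (x : 'I_4) : [\/ x = x0, x = x1 | x = x2] \/ x = x3.
  case: x => [[|[|[|[|//]]]] hx].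
  - by left; constructor 1; apply/val_inj.
  - by left; constructor 2; apply/val_inj.
  - by left; constructor 3; apply/val_inj.
  - by right; apply/val_inj.
case E0: (x0 \in X); case E1: (x1 \in X) => //; case E2: (x2 \in X) => //;
  case E3: (x3 \in X) => // _ _ _; [right | left]; apply/setP=> x; rewrite !inE;
  by case: (P x) => [[]|] ->.
Qed.

Lemma K4_labelling : labelling K4_label.
Proof.
apply: labelling_of_flow => //.
- by rewrite card_ord.
- exact: K4_connected.
- rewrite card_ord -sum1_card; apply: etrans (big_K4 _ _) _; exact: erefl.
- move=> w hw; apply: ldot_eq0; [exact: (hw e01) | exact: (hw e02) | exact: (hw e12)].
- exact: K4_flow.
Qed.

Lemma sum_contract (G : mgraph) (Z : {set edge G}) (R : nmodType) (F : edge G -> R) :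
  \sum_(d : edge (contract Z)) F (val d) = \sum_(e | e \notin Z) F e.
Proof. exact/esym/(big_sub (fun e : edge G => e \notin Z)). Qed.

Lemma sum_subdivide (D : mgraph) (l : edge D -> nat) (R : nmodType)
    (F : forall d : edge D, 'I_(l d) -> R) :
  \sum_(a : edge (subdivide l)) F (tag a) (tagged a) = \sum_d \sum_(i < l d) F d i.
Proof.
by rewrite (sig_big_dep xpredT (fun _ _ => true) F).
Qed.

Section WeakSubdivision.
Variable l : edge K4 -> nat.
Local Notation Z := [set e | l e == 0%N].
Local Notation D := (contract Z).
Local Notation W := (weak_subdivision l).

Definition chain_label (a : edge W) : label := K4_label (val (tag a)).

(** Dual form of the condition that the zero chains form a forest in $K_4$. *)
Hypothesis l_spanning : forall w, (forall e, (0 < l e)%N -> ldot w (K4_label e) = false) -> w = 0.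

Lemma chain_positive (d : edge D) : (0 < l (val d))%N.
Proof. by have := valP d; rewrite inE lt0n. Qed.

(** A chain of length [l] has only [l - 1] new vertices, so the lookup fails at the last position
    and returns the target. *)
Lemma chain_vertex_last (d : edge D) :
  chain_vertex (fun d : edge D => l (val d)) d (l (val d)) = inl (tgt d).
Proof.
move: (chain_positive d) {1 3}(l (val d)) (erefl (l (val d))) => pos [|j] /= ej.
  by rewrite -ej in pos.
by rewrite insubF // -ej /= ltnn.
Qed.

Lemma telescope_addb (b : nat -> bool) (u : label) n :
  \sum_(i < n) (if b i (+) b i.+1 then u else 0) = if b 0%N (+) b n then u else 0.
Proof.
elim: n => [|n IHn]; first by rewrite big_ord0 addbb.
rewrite big_ord_recr /= IHn.
by case: (b 0%N); case: (b n); case: (b n.+1); rewrite /= ?addr0 ?add0r ?label_addxx.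
Qed.

(** The edges of a chain share a label, so their contributions telescope to whether [X] separates
    the ends of the chain. What remains is a cut of the contraction, hence of $K_4$. *)
Lemma weak_subdivision_flow (X : {set vertex W}) : \sum_(a in cut X) chain_label a = 0.
Proof.
rewrite big_mkcond.
pose F (d : edge D) (i : 'I_(l (val d))) : label :=
  let b j := chain_vertex (fun d : edge D => l (val d)) d j \in X in
  if b i (+) b i.+1 then K4_label (val d) else 0.
rewrite (eq_bigr (fun a => F (tag a) (tagged a))); last first.
  by move=> a _; rewrite inE /F.
rewrite (sum_subdivide F) /F.
pose Y : {set vertex D} := [set x | inl x \in X].
rewrite (eq_bigr (fun d : edge D => if d \in cut Y then K4_label (val d) else 0)); last first.
  move=> d _; rewrite (telescope_addb
    (fun j => chain_vertex (fun d : edge D => l (val d)) d j \in X)).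
  by rewrite chain_vertex_last !inE.
rewrite -big_mkcond /=.
transitivity (\sum_(e in val @: cut Y) K4_label e).
  by rewrite big_imset //= => x y _ _; exact: val_inj.
by rewrite cut_contract K4_flow.
Qed.

Lemma weak_subdivision_connected : cut_connected W.
Proof.
have conD : cut_connected D by exact: cut_connected_contract K4_connected.
move=> X X0; pose Y : {set vertex D} := [set x | inl x \in X].
have const (d : edge D) i : (i <= l (val d))%N ->
    (chain_vertex (fun d : edge D => l (val d)) d i \in X) = (src d \in Y).
  elim: i => [|i IHi] hi; first by rewrite inE.
  rewrite -IHi; last exact: ltnW.
  move/setP/(_ (Tagged (fun d : edge D => 'I_(l (val d))) (Ordinal hi))): X0.
  by rewrite !inE /=; do 2!case: (_ \in X).
have Y0 : cut Y = set0.
  apply/setP=> d; rewrite inE in_set0 -(const d _ (leqnn _)) chain_vertex_last.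
  by rewrite inE addbb.
have inner (d : edge D) (k : 'I_(l (val d)).-1) :
    inr (Tagged (fun d : edge D => 'I_(l (val d)).-1) k)
      = chain_vertex (fun d : edge D => l (val d)) d k.+1.
  rewrite /chain_vertex insubT //= => hk; congr (inr (Tagged _ _)).
  exact: val_inj.
have kle (d : edge D) (k : 'I_(l (val d)).-1) : (k.+1 <= l (val d))%N.
  by have := chain_positive d; have := ltn_ord k; lia.
case: (conD Y Y0) => /setP hY; [left | right]; apply/setP=> -[x|[d k]].
- by have := hY x; rewrite !inE.
- by rewrite (inner d k) const ?kle // hY !inE.
- by have := hY x; rewrite !inE.
- by rewrite (inner d k) const ?kle // hY !inE.
Qed.

Lemma card_weak_subdivision_edge : #|edge W| = (\sum_e l e)%N.
Proof.
rewrite -sum1_card.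
rewrite (sum_subdivide (D := D) (l := fun d => l (val d)) (R := nat) (fun _ _ => 1%N)).
rewrite (eq_bigr (fun d : edge D => l (val d))); last first.
  by move=> d _; rewrite sum_nat_const card_ord muln1.
rewrite (sum_contract Z l) [LHS]big_mkcond; apply: eq_bigr => e _.
by rewrite inE; case: eqVneq.
Qed.

Lemma card_contract_vertex : #|edge D| = (#|vertex D| + 2)%N.
Proof.
apply: (@labelling_card D (K4_label \o val)).
- by apply/card_gt0P; exists (contract_proj Z (ord0 : 'I_4)).
- exact: cut_connected_contract K4_connected.
- move=> w hw; apply: l_spanning => e le.
  have he : e \notin Z by rewrite inE -lt0n.
  exact: (hw (Sub e he)).
- exact: labelling_contract K4_labelling.
Qed.

Lemma card_weak_subdivision : #|edge W| = (#|vertex W| + 2)%N.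
Proof.
have new : #|({d : edge D & 'I_(l (val d)).-1} : finType)| = (\sum_(d : edge D) (l (val d)).-1)%N.
  rewrite -sum1_card; apply: etrans (esym (sig_big_dep xpredT (fun _ _ => true)
    (fun (d : edge D) (_ : 'I_(l (val d)).-1) => 1%N))) _.
  by apply: eq_bigr => d _; rewrite sum_nat_const card_ord muln1.
have sum1 : (\sum_(d : edge D) (l (val d)).-1 + #|edge D| = \sum_e l e)%N.
  rewrite -sum1_card -big_split /=.
  rewrite (eq_bigr (fun d : edge D => l (val d))); last first.
    by move=> d _; rewrite addn1 prednK // chain_positive.
  rewrite (sum_contract Z l) [LHS]big_mkcond; apply: eq_bigr => e _.
  by rewrite inE; case: eqVneq.
rewrite card_weak_subdivision_edge card_sum new.
have := card_contract_vertex; lia.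
Qed.

Lemma weak_subdivision_vertex_gt0 : (0 < #|vertex W|)%N.
Proof. by apply/card_gt0P; exists (inl (contract_proj Z (ord0 : 'I_4))). Qed.

Lemma chain_label_onto e : (0 < l e)%N -> exists a, chain_label a = K4_label e.
Proof.
move=> le; have he : e \notin Z by rewrite inE -lt0n.
by exists (Tagged (fun d : edge D => 'I_(l (val d)))
  (Ordinal le : 'I_(l (val (Sub e he : edge D))))).
Qed.

Lemma weak_subdivision_labelling : labelling chain_label.
Proof.
apply: labelling_of_flow.
- exact: weak_subdivision_vertex_gt0.
- exact: weak_subdivision_connected.
- exact: card_weak_subdivision.
- move=> w hw; apply: l_spanning => e le.
  by have [a <-] := chain_label_onto le.
- exact: weak_subdivision_flow.
Qed.

Lemma mult_chain_label e : mult chain_label (K4_label e) = l e.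
Proof.
rewrite /mult -sum1dep_card big_mkcond.
pose F (d : edge D) (_ : 'I_(l (val d))) : nat :=
  if K4_label (val d) == K4_label e then 1%N else 0%N.
rewrite (sum_subdivide (R := nat) F) /F.
rewrite (eq_bigr (fun d : edge D => if val d == e then l e else 0%N)); last first.
  move=> d _; rewrite sum_nat_const card_ord (inj_eq K4_label_inj).
  by case: eqP => [->|_]; rewrite ?muln1 ?muln0.
rewrite (sum_contract Z (fun f => if f == e then l e else 0%N)) big_mkcond.
rewrite (bigD1 e) //= eqxx big1 => [|f /negbTE ->]; last by rewrite if_same.
by rewrite inE addr0; case: eqP.
Qed.

Lemma chain_label_neq0 a : chain_label a != 0.
Proof. exact: K4_label_neq0. Qed.

Lemma mult_chain_label1 : mult chain_label (true, true, true) = 0%N.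
Proof. by apply/mult0P => a; exact: K4_label_neq1. Qed.
End WeakSubdivision.

Lemma joins_cut (G : mgraph) (e : edge G) x y (X : {set vertex G}) :
  joins e x y -> (e \in cut X) = (x \in X) (+) (y \in X).
Proof. by rewrite inE /joins => /orP[] /andP[/eqP-> /eqP->] //; rewrite addbC. Qed.

Lemma walk_cut (G : mgraph) (X : {set vertex G}) s x :
  walk x s -> \sum_(a <- s) (a.1 \in cut X : bool) = (x \in X) (+) (last x (unzip2 s) \in X).
Proof.
elim: s x => [|[e y] s IHs] x /=; first by rewrite big_nil addbb.
case/andP=> exy /IHs; rewrite big_cons => -> /=; rewrite (joins_cut X exy).
by case: (x \in X); case: (y \in X); case: (_ \in X).
Qed.

(** A closed walk crosses every cut an even number of times, but a cycle of zero edges through [e]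
    would cross [X] only at [e]. *)
Lemma positive_cycles_of_cuts (G : mgraph) (l : edge G -> nat) :
  (forall e, l e = 0%N -> exists2 X, e \in cut X & forall f, l f = 0%N -> f \in cut X -> f = e) ->
  positive_cycles l.
Proof.
move=> sep x s /and5P[s0 wx /eqP lx _ us]; rewrite lt0n; apply/negP.
rewrite sum_nat_seq_eq0 => /allP l0.
case: s s0 wx lx us l0 => [//|[e y] s] _ wx lx /= /andP[es us] l0.
have [X eX uX] := sep e (eqP (l0 (e, y) (mem_head _ _))).
have := walk_cut X wx; rewrite lx addbb big_cons /= eX big1_seq // => -[f z] /andP[_ fs] /=.
suff nf : f \notin cut X by exact: negbTE nf.
apply/negP=> fX; have /eqP lf := l0 (f, z) (mem_behead (s := (e, y) :: s) fs).
have fe := uX f lf fX.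
by case/negP: es; rewrite -fe; apply: (map_f fst fs).
Qed.

Lemma isomorphic_trans (G H K : mgraph) :
  isomorphic G H -> isomorphic H K -> isomorphic G K.
Proof.
move=> [f [g [f_bij g_bij fg]]] [f' [g' [f_bij' g_bij' fg']]].
exists (f' \o f), (g' \o g); split; try exact: bij_comp.
move=> e /=; have := fg' (g e); case/orP: (fg e) => /andP[/eqP-> /eqP->] //.
by rewrite /joins orbC.
Qed.

(** A good pattern of weight at least 3 contains an opposite pair and a further edge. The pair spans
    a line through the missing label, and the further label lies off that line. *)
Lemma good_pattern_spanning (beta : label -> bool) w :
  good_pattern beta -> (3 <= weight beta)%N ->
  (forall u, u != 0 -> u != (true, true, true) -> beta u -> ldot w u = false) -> w = 0.
Proof.
move=> good w3 h; have {}h u : u != 0 -> u != (true, true, true) -> beta u ==> ~~ ldot w u.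
  by move=> u0 u1; apply/implyP=> /(h u u0 u1) ->.
move: good w3 (h (true, false, false) isT isT) (h (false, true, true) isT isT)
  (h (false, true, false) isT isT) (h (true, false, true) isT isT)
  (h (false, false, true) isT isT) (h (true, true, false) isT isT).
rewrite /good_pattern /weight; clear h.
move: (beta _) (beta _) (beta _) (beta _) (beta _) (beta _).
by do 6 case; rewrite ?inE //= => _ _; case: w => [[[] []] []].
Qed.

Section K4Profile.
Variables (l : edge K4 -> nat) (q : nat) (beta : label -> bool).
Hypothesis lE : forall e, l e = (q + beta (K4_label e))%N.

Lemma sum_chain_lengths : (\sum_e l e = 6 * q + weight beta)%N.
Proof. by rewrite big_K4 /= !lE /weight /K4_label /=; lia. Qed.

Hypotheses (good : good_pattern beta) (w6 : (weight beta < 6)%N).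
Hypothesis l3 : (3 <= \sum_e l e)%N.

Lemma chains_spanning w :
  (forall e, (0 < l e)%N -> ldot w (K4_label e) = false) -> w = 0.
Proof.
move=> h; case: (posnP q) => [q0|qpos]; last first.
  by apply: ldot_eq0; [apply: (h e01) | apply: (h e02) | apply: (h e12)]; rewrite lE; lia.
apply: (good_pattern_spanning good) => [|u u0 u1 bu].
  by move: l3; rewrite sum_chain_lengths; lia.
by rewrite -(edge_of_labelK u0 u1); apply: h; rewrite lE edge_of_labelK // bu; lia.
Qed.

Lemma chains_optimal_profile : optimal_profile q (mult (@chain_label l)).
Proof.
exists beta; split=> // u u0 u1.
by rewrite -{1}(edge_of_labelK u0 u1) mult_chain_label lE edge_of_labelK.
Qed.
End K4Profile.

(** Excluding the twelve pairs of adjacent edges leaves only the opposite pairs. *)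
Lemma matching_good_pattern (S : {set edge K4}) (beta : label -> bool) :
  matching S -> (forall e, beta (K4_label e) = (e \in S)) ->
  (weight beta == 2)%N -> good_pattern beta.
Proof.
move=> [_ mS] bS.
have no e f x : e != f -> incident e x -> incident f x ->
    beta (K4_label e) && beta (K4_label f) = false.
  move=> ef ex fx; apply/negP; rewrite !bS => /andP[eS fS].
  by case/eqP: ef; exact: mS eS fS ex fx.
pose x0 : vertex K4 := Ordinal (isT : 0 < 4)%N; pose x1 : vertex K4 := Ordinal (isT : 1 < 4)%N.
pose x2 : vertex K4 := Ordinal (isT : 2 < 4)%N; pose x3 : vertex K4 := Ordinal (isT : 3 < 4)%N.
move: (no e01 e02 x0 isT isT isT) (no e01 e03 x0 isT isT isT) (no e02 e03 x0 isT isT isT)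
  (no e01 e12 x1 isT isT isT) (no e01 e13 x1 isT isT isT) (no e12 e13 x1 isT isT isT)
  (no e02 e12 x2 isT isT isT) (no e02 e23 x2 isT isT isT) (no e12 e23 x2 isT isT isT)
  (no e03 e13 x3 isT isT isT) (no e03 e23 x3 isT isT isT) (no e13 e23 x3 isT isT isT).
rewrite /K4_label /= /good_pattern /weight; clear.
move: (beta _) (beta _) (beta _) (beta _) (beta _) (beta _).
by do 6 case.
Qed.

(** The first and last edges of a path with three edges are disjoint, hence opposite. *)
Lemma path_good_pattern (S : {set edge K4}) (beta : label -> bool) :
  simple_path_edges 3 S -> (forall e, e \in S -> beta (K4_label e)) ->
  (weight beta == 3)%N -> good_pattern beta.
Proof.
move=> [x [s [ss ws us eS]]] bS w3.
case: s ss ws us eS => [|[f1 y1] [|[f2 y2] [|[f3 y3] [|]]]] //= _.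
move=> /and4P[j1 _ j3 _] us eS.
have b1 : beta (K4_label f1) by apply: bS; rewrite eS !inE eqxx.
have b3 : beta (K4_label f3) by apply: bS; rewrite eS !inE eqxx !orbT.
have [n1 n2 n3 n4] : [/\ x != y2, x != y3, y1 != y2 & y1 != y3].
  by move: us; rewrite !inE !negb_or => /and4P[/and3P[_ -> ->] /andP[-> ->] _ _].
have : [&& src f1 != src f3, src f1 != tgt f3, tgt f1 != src f3 & tgt f1 != tgt f3].
  by case/orP: j1 => /andP[/eqP-> /eqP->]; case/orP: j3 => /andP[/eqP-> /eqP->];
    rewrite n1 n2 n3 n4.
rewrite /good_pattern (eqP w3) /=.
case: (K4_edgeP f1) b1 => -[] -> /=; rewrite /K4_label /= => b1;
case: (K4_edgeP f3) b3 => -[] -> /=; rewrite /K4_label /= => b3 //=;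
by rewrite b1 b3 ?orbT.
Qed.

(** Balanced lengths take only the values [k0] and [k0 + 1], where [k0] is the integer part of their
    mean. The statement's [q] is [k0] with at most three longer chains and [k0 + 1] otherwise. *)
Lemma balanced_pattern (l : edge K4 -> nat) (q r : int) :
  (\sum_e l e)%:Z = 6 * q + r -> -2 <= r <= 3 -> balanced l -> chain_conditions l q r ->
  exists beta : label -> bool, [/\ forall e, l e = ((\sum_e l e) %/ 6 + beta (K4_label e))%N,
    good_pattern beta & (weight beta < 6)%N].
Proof.
move=> lqr hr bal [c2 c2' c3].
pose k0 := ((\sum_e l e) %/ 6)%N.
pose beta u := l (edge_of_label u) == k0.+1.
have near e : l e = k0 \/ l e = k0.+1.
  have := bal; rewrite /balanced => b.
  have sumE : (\sum_e l e = l e01 + (l e02 + (l e03 + (l e12 + (l e13 + l e23)))))%N.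
    exact: big_K4.
  have k0E : (6 * k0 <= \sum_e l e < 6 * k0 + 6)%N by rewrite /k0; lia.
  have := b e e01; have := b e e02; have := b e e03; have := b e e12; have := b e e13.
  have := b e e23; have := b e01 e; have := b e02 e; have := b e03 e; have := b e12 e.
  have := b e13 e; have := b e23 e; move: k0E; rewrite sumE; clear.
  by case: (K4_edgeP e) => -[] ->; lia.
have betaE e : beta (K4_label e) = (l e == k0.+1).
  by case: (K4_edgeP e) => -[] ->.
have lE e : l e = (k0 + beta (K4_label e))%N.
  by rewrite betaE; case: (near e) => ->; [case: eqP; lia | rewrite eqxx; lia].
have wE : (\sum_e l e = 6 * k0 + weight beta)%N.
  by rewrite big_K4 /= !lE /weight /K4_label /=; lia.
have w6 : (weight beta < 6)%N by move: (wE); rewrite /k0; lia.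
exists beta; split=> //.
have kq : (weight beta <= 3)%N -> q = k0%:Z /\ r = (weight beta)%:Z by lia.
have kq' : (3 < weight beta)%N -> q = k0%:Z + 1 /\ r = (weight beta)%:Z - 6 by lia.
case: (eqVneq (weight beta) 2%N) => [w2|w2].
  have [qE rE] : q = k0%:Z /\ r = (weight beta)%:Z by apply: kq; rewrite w2.
  apply: (matching_good_pattern (c2 _)); rewrite ?w2 //; first by rewrite rE w2.
  by move=> e; rewrite betaE inE qE; lia.
case: (eqVneq (weight beta) 3%N) => [w3|w3].
  have [qE rE] : q = k0%:Z /\ r = (weight beta)%:Z by apply: kq; rewrite w3.
  apply: (path_good_pattern (c3 _)); rewrite ?w3 //; first by rewrite rE w3.
  by move=> e; rewrite betaE inE qE; lia.
case: (eqVneq (weight beta) 4%N) => [w4|w4]; last first.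
  by rewrite /good_pattern !inE (negbTE w2) (negbTE w3) (negbTE w4).
have [qE rE] : q = k0%:Z + 1 /\ r = (weight beta)%:Z - 6 by apply: kq'; rewrite w4.
(* For $r=-2$ the matching consists of the shorter chains, the complement of [beta]; the condition
   for weights 2 and 4 is invariant under complement. *)
have : good_pattern (fun u => ~~ beta u).
  apply: (matching_good_pattern (c2' _)); first by rewrite rE w4.
    by move=> e; rewrite betaE inE qE; case: (near e) => ->; lia.
  by move: w4; rewrite /weight; do 6 case: (beta _).
move: w4; rewrite /good_pattern /weight.
by do 6 case: (beta _).
Qed.

Section StandardLengths.
Variables (q k : nat).
Definition standard_length (e : edge K4) : nat := (q + standard_pattern k (K4_label e))%N.
Local Notation l := standard_length.

Lemma standard_good : good_pattern (standard_pattern k).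
Proof. by case: k => [|[|[|[|[|n]]]]]. Qed.

Hypothesis k6 : (k < 6)%N.

Lemma standard_weight : weight (standard_pattern k) = k.
Proof. by case: k k6 => [|[|[|[|[|[|]]]]]]. Qed.

Lemma standard_balanced : balanced l.
Proof. by move=> e f; rewrite /l; case: (standard_pattern _ _); lia. Qed.

Lemma standard_positive_cycles : (3 <= 6 * q + k)%N -> positive_cycles l.
Proof.
move=> qk; apply: positive_cycles_of_cuts => e l0.
have q0 : q = 0%N by move: l0; rewrite /l; lia.
have k3 : (3 <= k)%N by lia.
have zero f : l f = 0%N -> ~~ standard_pattern k (K4_label f).
  by rewrite /l; case: (standard_pattern _ _); lia.
pose x0 : vertex K4 := Ordinal (isT : 0 < 4)%N; pose x1 : vertex K4 := Ordinal (isT : 1 < 4)%N.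
pose x2 : vertex K4 := Ordinal (isT : 2 < 4)%N.
have found X : e \in cut X ->
    (forall f, ~~ standard_pattern k (K4_label f) -> f \in cut X -> f = e) ->
    exists2 X, e \in cut X & forall f, l f = 0%N -> f \in cut X -> f = e.
  by move=> eX uX; exists X => // f /zero; exact: uX.
have := zero e l0; clear l0 zero.
(* The zero chains form a path, a matching or a single edge for $k=3,4,5$. Each set given below has
   a cut meeting them only in [e]. *)
case: k k6 k3 found => [|[|[|[|[|[|]]]]]] //= _ _ found.
- case: (K4_edgeP e) found => -[] -> // found _.
  + apply: (found [set x2]); first by rewrite !inE.
    by move=> f; case: (K4_edgeP f) => -[] -> //; rewrite !inE.
  + apply: (found [set x0; x2]); first by rewrite !inE.
    by move=> f; case: (K4_edgeP f) => -[] -> //; rewrite !inE.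
  + apply: (found [set x1]); first by rewrite !inE.
    by move=> f; case: (K4_edgeP f) => -[] -> //; rewrite !inE.
- case: (K4_edgeP e) found => -[] -> // found _.
  + apply: (found [set x0]); first by rewrite !inE.
    by move=> f; case: (K4_edgeP f) => -[] -> //; rewrite !inE.
  + apply: (found [set x2]); first by rewrite !inE.
    by move=> f; case: (K4_edgeP f) => -[] -> //; rewrite !inE.
- case: (K4_edgeP e) found => -[] -> // found _.
  apply: (found [set x0]); first by rewrite !inE.
  by move=> f; case: (K4_edgeP f) => -[] -> //; rewrite !inE.
Qed.

Lemma card_chains (t : int) : #|chains l t| =
  ((l e01 == t :> int) + ((l e02 == t :> int) + ((l e03 == t :> int) +
   ((l e12 == t :> int) + ((l e13 == t :> int) + (l e23 == t :> int))))))%N.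
Proof.
rewrite -sum1dep_card big_mkcond; apply: etrans (big_K4 _ _) _ => /=.
by do 6 case: (_ == t).
Qed.

Lemma standard_quotient (q' r : int) : (6 * q + k)%N%:Z = 6 * q' + r -> -2 <= r <= 3 ->
  (k <= 3)%N /\ q' = q%:Z /\ r = k%:Z \/ (3 < k)%N /\ q' = q%:Z + 1 /\ r = k%:Z - 6.
Proof. by lia. Qed.

Lemma standard_counts (q' r : int) : (6 * q + k)%N%:Z = 6 * q' + r -> -2 <= r <= 3 ->
  chain_counts l q' r.
Proof.
move=> e hr; rewrite /chain_counts !card_chains /l.
case: (standard_quotient e hr) => -[hk [-> ->]]; clear e hr.
  by case: k k6 hk => [|[|[|[|[|[|]]]]]] //= _ _; split=> [|r0];
    rewrite /standard_pattern /K4_label ?inE /=; lia.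
by case: k k6 hk => [|[|[|[|[|[|]]]]]] //= _ _; split=> [|r0];
  rewrite /standard_pattern /K4_label ?inE /=; lia.
Qed.

Lemma standard_chains (t : int) : chains l t =
  [set e | q%:Z + (standard_pattern k (K4_label e))%:Z == t].
Proof. by apply/setP=> e; rewrite !inE. Qed.

Lemma opposite_matching : matching [set e01; e23].
Proof.
split=> [e|e f x]; rewrite !inE; first by case/orP=> /eqP->.
case/orP=> /eqP->; case/orP=> /eqP-> //; rewrite /incident /=.
  by case/orP=> /eqP <-; case/orP=> /eqP.
by case/orP=> /eqP <-; case/orP=> /eqP.
Qed.

Lemma standard_conditions (q' r : int) : (6 * q + k)%N%:Z = 6 * q' + r -> -2 <= r <= 3 ->
  chain_conditions l q' r.
Proof.
move=> e hr; have := standard_quotient e hr => cases.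
split=> rE.
- have [k2 qE] : k = 2%N /\ q' = q by lia.
  have E0 : (q%:Z + 0%:Z == q%:Z + 1) = false by lia.
  have E1 : (q%:Z + 1%:Z == q%:Z + 1) = true by lia.
  rewrite standard_chains qE k2 (_ : [set _ | _] = [set e01; e23]); first exact: opposite_matching.
  by apply/setP=> f; rewrite !inE; case: (K4_edgeP f) => -[] ->; rewrite ?E0 ?E1.
- have [k4 qE] : k = 4%N /\ q' = q%:Z + 1 by lia.
  have E0 : (q%:Z + 0%:Z == q%:Z + 1 - 1) = true by lia.
  have E1 : (q%:Z + 1%:Z == q%:Z + 1 - 1) = false by lia.
  rewrite standard_chains qE k4 (_ : [set _ | _] = [set e01; e23]); first exact: opposite_matching.
  by apply/setP=> f; rewrite !inE; case: (K4_edgeP f) => -[] ->; rewrite ?E0 ?E1.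
- have [k3 qE] : k = 3%N /\ q' = q by lia.
  have E0 : (q%:Z + 0%:Z == q%:Z + 1) = false by lia.
  have E1 : (q%:Z + 1%:Z == q%:Z + 1) = true by lia.
  rewrite standard_chains qE k3.
  exists (Ordinal (isT : 0 < 4)%N : vertex K4).
  exists [:: (e01, Ordinal (isT : 1 < 4)%N); (e12, Ordinal (isT : 2 < 4)%N);
             (e23, Ordinal (isT : 3 < 4)%N)].
  split=> //; apply/setP=> f; rewrite !inE.
  by case: (K4_edgeP f) => -[] ->; rewrite ?E0 ?E1.
Qed.
End StandardLengths.

Theorem theorem8p3 (R : realType) (n m : nat) (hn : (1 <= n)%N)
    (hm : m = (n + 2)%N) :
  exists G : mgraph,
    uniquely_optimal R n m G /\
    forall q r : int, m%:Z = 6 * q + r -> -2 <= r <= 3 ->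
      (exists l : edge K4 -> nat,
        [/\ is_weak_subdivision l G,
            balanced l,
            (4 <= n)%N -> forall e, (0 < l e)%N,
            chain_counts l q r
          & chain_conditions l q r]) /\
      (forall (H : mgraph) (l : edge K4 -> nat),
        graph_class n m H -> is_weak_subdivision l H -> balanced l ->
        chain_conditions l q r -> isomorphic H G).
Proof.
pose q0 := (m %/ 6)%N; pose k := (m %% 6)%N.
have k6 : (k < 6)%N by rewrite ltn_pmod.
have mE : m = (6 * q0 + k)%N by rewrite {1}(divn_eq m 6) mulnC.
pose l0 := standard_length q0 k.
have l0E e : l0 e = (q0 + standard_pattern k (K4_label e))%N by [].
have good0 := standard_good k; have weight0 := standard_weight k6.
have w6 : (weight (standard_pattern k) < 6)%N by rewrite weight0.
have sum0 : (\sum_e l0 e = m)%N by rewrite (sum_chain_lengths l0E) weight0.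
have span0 : forall w, (forall e, (0 < l0 e)%N -> ldot w (K4_label e) = false) -> w = 0.
  by apply: (chains_spanning l0E good0 w6); rewrite sum0 hm; lia.
pose G := weak_subdivision l0.
have eG : #|edge G| = m by rewrite card_weak_subdivision_edge.
have nG : #|vertex G| = n by have := card_weak_subdivision span0; rewrite -/G eG; lia.
have conG : cut_connected G by exact: weak_subdivision_connected.
have labG := weak_subdivision_labelling span0.
have optG := chains_optimal_profile l0E good0 w6.
have n0 : (0 < #|vertex G|)%N by rewrite nG.
have mG : #|edge G| = (#|vertex G| + 2)%N by rewrite eG nG.
exists G; split.
  split=> [|H [nH eH /connectedP conH] niso p p01]; first by split=> //; exact/connectedP.
  by apply: (optimal_uniquely_optimal n0 conG conH _ mG _ labG (@chain_label_neq0 l0)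
     (@mult_chain_label1 l0) optG niso p01); rewrite ?nH ?nG ?eH ?eG.
move=> q r mqr hr; split.
  have mqr' : (6 * q0 + k)%N%:Z = 6 * q + r by rewrite -mE.
  exists l0; split.
  - split; first by apply: (standard_positive_cycles k6); rewrite -mE hm; lia.
    by exists id, id; split=> [||e]; [by exists id | by exists id | rewrite /joins /= !eqxx].
  - exact: standard_balanced.
  (* Four vertices mean at least six edges, so every chain has length at least 1. *)
  - move=> n4 e; have q0_gt0 : (0 < q0)%N by lia.
    rewrite l0E; lia.
  - exact: standard_counts.
  - exact: standard_conditions.
move=> H l [nH eH _] [_ HW] bal cond; apply: (isomorphic_trans HW).
have cardWH : #|edge (weak_subdivision l)| = m.
  by case: HW => f [g [_ g_bij _]]; rewrite -(bij_eq_card g_bij).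
have sumE : (\sum_e l e = m)%N by rewrite -card_weak_subdivision_edge.
(* The lengths add up to [m], so both graphs have the same base length [q0], and their profiles are
   optimal for the same [q0]. *)
have [beta [lE good wb]] : exists beta : label -> bool,
    [/\ forall e, l e = (q0 + beta (K4_label e))%N, good_pattern beta & (weight beta < 6)%N].
  have := @balanced_pattern l q r; rewrite sumE -/q0; exact.
have spanW : forall w, (forall e, (0 < l e)%N -> ldot w (K4_label e) = false) -> w = 0.
  by apply: (chains_spanning lE good wb); rewrite sumE hm; lia.
have mW := card_weak_subdivision spanW.
apply: (optimal_isomorphic _ _ _ conG _ mW mG (weak_subdivision_labelling spanW) labG
  (@chain_label_neq0 l) (@chain_label_neq0 l0) (@mult_chain_label1 l) (@mult_chain_label1 l0)
  (chains_optimal_profile lE good wb) optG) => //.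
- exact: weak_subdivision_vertex_gt0.
- exact: weak_subdivision_connected.
- by move: mW; rewrite cardWH nG hm; lia.
Qed.
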